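(* Let $0<s\le 3$ and write $s=m+\alpha$ with $m=\lceil s\rceil-1$ and $\alpha=s-m\in(0,1]$. Let $(r_n)_{n\ge 0}$ be a sequence of positive real numbers. (i) Let $X_n$, $n\ge 0$, be random variables in $\mathcal{C}_{r_n}[0,1]$, and let $X$ be a random variable in $\mathcal{C}[0,1]$. If $$\zeta_s(X_n,X)=o\bigl(\log^{-m}(1/r_n)\bigr)\qquad (n\to\infty),$$ then $X_n\to X$ in distribution in $(\mathcal{C}[0,1],\|\cdot\|_\infty)$. (ii) The assertion remains valid if $\mathcal{C}[0,1]$, $\mathcal{C}_{r_n}[0,1]$ are replaced by $\mathcal{D}[0,1]$, $\mathcal{D}_{r_n}[0,1]$ endowed with the Skorokhod topology and $X$ has continuous sample paths. That is: if $X_n$, $n\ge 0$, are random variables in $\mathcal{D}_{r_n}[0,1]$, $X$ is a random variable in $\mathcal{D}[0,1]$ with continuous sample paths, and $\zeta_s(X_n,X)=o(\log^{-m}(1/r_n))$ as $n\to\infty$, then $X_n\to X$ in distribution in $(\mathcal{D}[0,1],d_{\mathrm{sk}})$.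
   Context: $\mathcal{C}[0,1]$ is the space of continuous functions $[0,1]\to\mathbb{R}$ with the norm $\|f\|_\infty=\sup_{t}|f(t)|$ and its Borel $\sigma$-algebra. $\mathcal{D}[0,1]$ is the space of càdlàg functions $[0,1]\to\mathbb{R}$ with the Skorokhod metric $d_{\mathrm{sk}}$ ($d_{\mathrm{sk}}(f,g)$ is the infimum of all $\varepsilon>0$ such that for some increasing bijection $\tau$ of $[0,1]$ one has $|f(t)-g(\tau(t))|<\varepsilon$ and $|\tau(t)-t|<\varepsilon$ for all $t$) and the Borel $\sigma$-algebra of $d_{\mathrm{sk}}$. For $r>0$, $\mathcal{C}_r[0,1]$ is the set of $f\in\mathcal{C}[0,1]$ for which there are $0=t_1<t_2<\dots<t_\ell=1$ with $|t_i-t_{i-1}|\ge r$ and $f|_{[t_{i-1},t_i]}$ linear (affine) for $i=2,\dots,\ell$. $\mathcal{D}_r[0,1]$ is the set of $f\in\mathcal{D}[0,1]$ for which there are $0=t_1<\dots<t_\ell=1$ with $|t_i-t_{i-1}|\ge r$ and $f|_{[t_{i-1},t_i)}$ constant for $i=2,\dots,\ell$, and $f$ continuous at $1$. Zolotarev metric: for $s>0$ put $m=\lceil s\rceil-1$, $\alpha=s-m$. With $B=\mathcal{C}[0,1]$ or $\mathcal{D}[0,1]$ (in both cases differentiability is Fréchet differentiability with respect to $\|\cdot\|_\infty$), $\mathcal{F}_s$ is the set of $m$-times continuously differentiable $f:B\to\mathbb{R}$ with $\|D^mf(x)-D^mf(y)\|\le\|x-y\|_\infty^{\alpha}$ for all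 $x,y\in B$, where the norm of a continuous $m$-linear form $g$ is $\sup_{\|h_i\|_\infty\le1}|g(h_1,\dots,h_m)|$. For $B$-valued random variables $X,Y$, $\zeta_s(X,Y)=\sup_f|\mathbf{E}[f(X)-f(Y)]|$, where the supremum is over $f\in\mathcal{F}_s$ if $B=\mathcal{C}[0,1]$ and over those $f\in\mathcal{F}_s$ that are Borel measurable with respect to $d_{\mathrm{sk}}$ if $B=\mathcal{D}[0,1]$.
   Formalization: The rate hypothesis is read as ζ_s(X_n,X)·log^m(1/r_n)→0 together with ζ_s(X_n,X)→0; the second part is added because for m≥1 and r_n→1 the rate log^{-m}(1/r_n) is unbounded (undefined at r_n=1) and the literal claim fails, e.g. s=2, X=±1, X_n=±2 constant paths. *)

(* Defs.v *)
(* Real functions on [0, 1] are encoded as functions R -> R that vanish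
   outside [0, 1], so that equality of functions on [0, 1] is Leibniz equality
   and one-sided limits at t are taken along t^'- and t^'+. *)
From HB Require Import structures.
From mathcomp Require Import all_boot all_order all_algebra.
From mathcomp Require Import all_classical all_reals all_analysis.
From mathcomp Require Import lra.

Set Implicit Arguments.
Unset Strict Implicit.
Unset Printing Implicit Defensive.

Import Order.TTheory GRing.Theory Num.Theory.
Import numFieldNormedType.Exports.

Local Open Scope classical_set_scope.
Local Open Scope ring_scope.

Section paths.
Context {R : realType}.
Implicit Types (f g : R -> R) (t : R).

Definition supported01 f := forall t, t \notin `[0, 1] -> f t = 0.

Definition continuous01 f := supported01 f /\ {within `[0, 1], continuous f}.

Definition cadlag01 f := [/\ supported01 f,
  forall t, 0 <= t < 1 -> f u @[u --> t^'+] --> f t &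
  forall t, 0 < t <= 1 -> cvg (f u @[u --> t^'-])].

Definition supnorm f : R := sup [set `|f t| | t in `[0, 1]].

Lemma continuous01_cadlag01 f : continuous01 f -> cadlag01 f.
Proof.
move=> [f0 /(continuous_within_itvP _ ltr01)[fc fr fl]]; split => //.
  move=> t /andP[]; rewrite le_eqVlt => /predU1P[<- _//|t0 t1].
  by apply: cvg_at_right_filter; apply: fc; rewrite in_itv/= t0.
move=> t /andP[t0]; rewrite le_eqVlt => /predU1P[->|t1].
  by apply/cvg_ex; exists (f 1).
apply/cvg_ex; exists (f t).
by apply: cvg_at_left_filter; apply: fc; rewrite in_itv/= t0.
Qed.

Lemma cadlag01_bounded f :
  cadlag01 f -> exists M, forall t, t \in `[0, 1] -> `|f t| <= M.
Proof.
move=> [f0 fr fl].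
have /compact_near_coveringP K : compact (`[0, 1]%classic : set R).
  exact: segment_compact.
have [t t01|M [_ MK]] := K _ (pinfty_nbhs R) (fun M t => `|f t| <= M) _.
  have [Mr rM] : exists M, \forall u \near t^'+, `|f u| <= M.
    move: t01; rewrite /= in_itv/= => /andP[t0].
    rewrite le_eqVlt => /predU1P[->|t1].
      exists 0; near=> u; rewrite f0 ?normr0// in_itv/= negb_and -!ltNge.
      by apply/orP; right.
    exists (`|f t| + 1); have : f u @[u --> t^'+] --> f t by apply: fr; rewrite t0.
    move=> /cvgrPdist_lt/(_ _ ltr01); apply: filterS => u fu.
    rewrite -[f u](subrK (f t)) addrC (le_trans (ler_normD _ _))// lerD2l.
    by rewrite distrC ltW.
  have [Ml lM] : exists M, \forall u \near t^'-, `|f u| <= M.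
    move: t01; rewrite /= in_itv/= => /andP[].
    rewrite le_eqVlt => /predU1P[<- _|t0 t1].
      exists 0; near=> u; rewrite f0 ?normr0// in_itv/= negb_and -!ltNge.
      by apply/orP; left.
    have /cvg_ex[/= l fl'] : cvg (f u @[u --> t^'-]) by apply: fl; rewrite t0.
    exists (`|l| + 1); move: fl' => /cvgrPdist_lt/(_ _ ltr01).
    apply: filterS => u fu.
    rewrite -[f u](subrK l) addrC (le_trans (ler_normD _ _))// lerD2l.
    by rewrite distrC ltW.
  pose M := Num.max (`|f t|) (Num.max Mr Ml).
  have near_bounded : \forall u \near t, `|f u| <= M.
    move: rM lM; rewrite /at_right /at_left !near_withinE => rM lM.
    near=> u; rewrite /M !le_max; have [ut|tu|->] := ltgtP u t.
    - by apply/orP; right; apply/orP; right; move: ut; near: u.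
    - by apply/orP; right; apply/orP; left; move: tu; near: u.
    - by rewrite lexx.
  exists ([set u | `|f u| <= M], [set N | M <= N]).
    split; first exact: near_bounded.
    by apply: nbhs_pinfty_ge; exact: num_real.
  by move=> [u N]/= [fu MN]; exact: le_trans MN.
exists (M + 1) => t t01; apply: (MK (M + 1)); first by rewrite ltrDl.
exact: t01.
Unshelve. all: by end_near. Qed.

Lemma supnorm_has_sup f : cadlag01 f -> has_sup [set `|f t| | t in `[0, 1]].
Proof.
move=> /cadlag01_bounded[M fM]; split.
  by exists (`|f 0|), 0 => //=; rewrite in_itv/= lexx ler01.
by exists M => _ [t t01 <-]; exact: fM.
Qed.

Lemma le_supnorm f t : cadlag01 f -> t \in `[0, 1] -> `|f t| <= supnorm f.
Proof.
by move=> /supnorm_has_sup [_ fM] t01; apply: ub_le_sup => //; exists t.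
Qed.

Lemma supnorm_le f M :
  (forall t, t \in `[0, 1] -> `|f t| <= M) -> supnorm f <= M.
Proof.
move=> fM; apply: ge_sup.
  by exists (`|f 0|), 0 => //=; rewrite in_itv/= lexx ler01.
by move=> _ [t t01 <-]; exact: fM.
Qed.

Lemma supnormD f g : cadlag01 f -> cadlag01 g ->
  supnorm (f + g) <= supnorm f + supnorm g.
Proof.
move=> cf cg; apply: supnorm_le => t t01.
by rewrite (le_trans (ler_normD _ _))// lerD// le_supnorm.
Qed.

Lemma supnormZ (a : R) f : cadlag01 f -> supnorm (a *: f) = `|a| * supnorm f.
Proof.
move=> cf; have H b h : cadlag01 h -> supnorm (b *: h) <= `|b| * supnorm h.
  move=> ch; apply: supnorm_le => t t01.
  by rewrite [_ t]/(b * h t) normrM ler_wpM2l// le_supnorm.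
apply/eqP; rewrite eq_le H//=.
have [->|a0] := eqVneq a 0.
  rewrite normr0 mul0r scale0r.
  apply: (@le_trans _ _ `|(0 : R -> R) 0|) => //.
  apply: ub_le_sup; last by exists 0 => //=; rewrite in_itv/= lexx ler01.
  by exists 0 => _ [t _ <-]; rewrite normr0.
rewrite -ler_pdivlMl ?normr_gt0//; apply: supnorm_le => t t01.
rewrite ler_pdivlMl ?normr_gt0// -normrM.
have [_ [M fM]] := supnorm_has_sup cf.
apply: ub_le_sup; last by exists t.
exists (`|a| * M) => _ [u u01 <-].
by rewrite [_ u]/(a * f u) normrM ler_wpM2l//; apply: fM; exists u.
Qed.

Lemma supnorm_eq0 f : cadlag01 f -> supnorm f = 0 -> f = 0.
Proof.
move=> cf f0; apply/funext => t.
have [t01|/negP t01] := boolP (t \in `[0, 1]); last first.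
  by case: cf => + _ _; apply; exact/negP.
by apply/eqP; rewrite -normr_le0 -f0 le_supnorm.
Qed.

Definition c01 : {pred R -> R} := [pred f | `[< continuous01 f >]].
Definition d01 : {pred R -> R} := [pred f | `[< cadlag01 f >]].

Lemma c01_submod : submod_closed c01.
Proof.
split.
  by apply/asboolP; split => // t; exact: cvg_cst.
move=> a f g /asboolP[f0 cf] /asboolP[g0 cg]; apply/asboolP; split.
  move=> t t01; have -> : (a *: f + g) t = a * f t + g t by [].
  by rewrite f0// g0// mulr0 addr0.
move=> t; have -> : a *: f + g = (fun t => a * f t + g t) by [].
apply: cvgD; last exact: cg.
by apply: cvgM; [exact: cvg_cst | exact: cf].
Qed.

Lemma d01_submod : submod_closed d01.
Proof.
split.
  apply/asboolP; split => // t _; first exact: cvg_cst.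
  exact: is_cvg_cst.
move=> a f g /asboolP[f0 fr fl] /asboolP[g0 gr gl]; apply/asboolP; split.
- move=> t t01; have -> : (a *: f + g) t = a * f t + g t by [].
  by rewrite f0// g0// mulr0 addr0.
- move=> t t01; have -> : a *: f + g = (fun t => a * f t + g t) by [].
  apply: cvgD; last exact: gr.
  by apply: cvgM; [exact: cvg_cst | exact: fr].
- move=> t t01; have -> : a *: f + g = (fun t => a * f t + g t) by [].
  apply: is_cvgD; last exact: gl.
  by apply: is_cvgM; [exact: is_cvg_cst | exact: fl].
Qed.

HB.instance Definition _ := GRing.isSubmodClosed.Build _ _ c01 c01_submod.
HB.instance Definition _ := GRing.isSubmodClosed.Build _ _ d01 d01_submod.

End paths.

Record C01 (R : realType) := MkC01 { c01_fun :> R -> R ; _ : c01_fun \in c01 }.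
Record D01 (R : realType) := MkD01 { d01_fun :> R -> R ; _ : d01_fun \in d01 }.

HB.instance Definition _ R := [isSub for @c01_fun R].
HB.instance Definition _ R := [Choice of C01 R by <:].
HB.instance Definition _ R := [SubChoice_isSubLmodule of C01 R by <:].

HB.instance Definition _ R := [isSub for @d01_fun R].
HB.instance Definition _ R := [Choice of D01 R by <:].
HB.instance Definition _ R := [SubChoice_isSubLmodule of D01 R by <:].

Section sup_normed_modules.
Context {R : realType}.

Lemma c01P (f : C01 R) : continuous01 f.
Proof. by case: f => f /= /asboolP. Qed.

Lemma d01P (f : D01 R) : cadlag01 f.
Proof. by case: f => f /= /asboolP. Qed.

Definition c01_norm (f : C01 R) := supnorm f.
Definition d01_norm (f : D01 R) := supnorm f.

Lemma c01_normD f g : c01_norm (f + g) <= c01_norm f + c01_norm g.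
Proof. by apply: supnormD; apply: continuous01_cadlag01; exact: c01P. Qed.

Lemma c01_normZ (a : R) f : c01_norm (a *: f) = `|a| * c01_norm f.
Proof. by apply: supnormZ; apply: continuous01_cadlag01; exact: c01P. Qed.

Lemma c01_norm_eq0 f : c01_norm f = 0 -> f = 0.
Proof.
move=> f0; apply/val_inj; apply: supnorm_eq0 f0.
by apply: continuous01_cadlag01; exact: c01P.
Qed.

Lemma d01_normD f g : d01_norm (f + g) <= d01_norm f + d01_norm g.
Proof. by apply: supnormD; exact: d01P. Qed.

Lemma d01_normZ (a : R) f : d01_norm (a *: f) = `|a| * d01_norm f.
Proof. by apply: supnormZ; exact: d01P. Qed.

Lemma d01_norm_eq0 f : d01_norm f = 0 -> f = 0.
Proof. by move=> f0; apply/val_inj; apply: supnorm_eq0 f0; exact: d01P. Qed.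

HB.instance Definition _ := Lmodule_isNormed.Build R (C01 R)
  c01_normD c01_normZ c01_norm_eq0.
HB.instance Definition _ := Lmodule_isNormed.Build R (D01 R)
  d01_normD d01_normZ d01_norm_eq0.

End sup_normed_modules.

HB.instance Definition _ (R : realType) :=
  Measurable.copy (C01 R) (g_sigma_algebraType (@open (C01 R))).

Section skorokhod.
Context {R : realType}.
Implicit Types f g h : D01 R.

Definition time_change (tau : R -> R) :=
  set_bij `[0, 1] `[0, 1] tau /\ {in `[0, 1] &, {homo tau : x y / x < y}}.

Definition sk_close f g (e : R) := exists2 tau, time_change tau &
  forall t, t \in `[0, 1] -> `|f t - g (tau t)| < e /\ `|tau t - t| < e.

Definition d_sk f g : R := inf [set e | 0 < e /\ sk_close f g e].

Lemma time_change_id : time_change id.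
Proof. by split => //; split => // x x01; exists x. Qed.

Lemma time_change_inv tau : time_change tau -> exists2 sigma, time_change sigma &
  forall t, t \in `[0, 1] -> sigma t \in `[0, 1] /\ tau (sigma t) = t.
Proof.
move=> [[tf ti ts] th].
have /choice[sigma sE] : forall y, exists x, y \in `[0, 1] -> x \in `[0, 1] /\ tau x = y.
  move=> y; have [y01|] := boolP (y \in `[0, 1]); last by exists 0.
  by have [x x01 <-] := ts _ y01; exists x.
exists sigma => //; split; first split.
- by move=> y y01; case: (sE _ y01).
- move=> x y; rewrite !inE => x01 y01 sxy.
  by have [_ <-] := sE _ x01; have [_ <-] := sE _ y01; rewrite sxy.
- move=> x x01; exists (tau x); first exact: tf.
  have [s01 sx] := sE _ (tf _ x01).
  by apply: ti; rewrite ?inE.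
- move=> x y x01 y01 xy; have [sx tx] := sE _ x01; have [sy ty] := sE _ y01.
  rewrite ltNge le_eqVlt; apply/negP => /predU1P[sxy|syx].
    by move: xy; rewrite -tx -ty sxy ltxx.
  by have := th _ _ sy sx syx; rewrite tx ty ltNge (ltW xy).
Qed.

Lemma time_change_comp tau sigma :
  time_change tau -> time_change sigma -> time_change (sigma \o tau).
Proof.
move=> [tb th] [sb sh]; split; first exact: set_bij_comp tb sb.
by move=> x y x01 y01 xy; case: tb => tf _ _; apply: sh (th _ _ _ _ xy) => //;
  apply: tf.
Qed.

Lemma sk_close_sym f g e : sk_close f g e -> sk_close g f e.
Proof.
move=> [tau tt fg]; have [sigma ts sE] := time_change_inv tt.
exists sigma => // t t01; have [st tst] := sE _ t01.
by have := fg _ st; rewrite tst distrC (distrC t).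
Qed.

Lemma sk_close_trans f g h e1 e2 :
  sk_close f g e1 -> sk_close g h e2 -> sk_close f h (e1 + e2).
Proof.
move=> [tau tt fg] [sigma ts gh]; exists (sigma \o tau).
  exact: time_change_comp.
move=> t t01; have [fg1 fg2] := fg _ t01.
have tt01 : tau t \in `[0, 1] by case: tt => [[tf _ _] _]; exact: tf.
have [gh1 gh2] := gh _ tt01; split.
  by rewrite (le_lt_trans (ler_distD (g (tau t)) _ _))// ltrD.
by rewrite [e1 + e2]addrC (le_lt_trans (ler_distD (tau t) _ _))// ltrD.
Qed.

Lemma sk_close_norm f g e : `|f - g| < e -> sk_close f g e.
Proof.
move=> fge; exists id; first exact: time_change_id.
move=> t t01; rewrite subrr normr0 (le_lt_trans (normr_ge0 _) fge); split => //.
exact: le_lt_trans (le_supnorm (d01P (f - g)) t01) fge.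
Qed.

Lemma d_sk_has_inf f g : has_inf [set e | 0 < e /\ sk_close f g e].
Proof.
split; last by exists 0 => e [/ltW].
exists (`|f - g| + 1); split; first by rewrite ltr_wpDl.
by apply: sk_close_norm; rewrite ltrDl.
Qed.

Lemma d_sk_lt f g e : d_sk f g < e -> 0 < e /\ sk_close f g e.
Proof.
move=> /(inf_lt (proj1 (d_sk_has_inf f g)))[e' [e'0 [tau tt fg]] e'e].
split; first exact: lt_trans e'e.
exists tau => // t /fg[fgt tt'].
by split; exact: lt_trans e'e.
Qed.

Lemma d_sk_le f g e : 0 < e -> sk_close f g e -> d_sk f g <= e.
Proof. by move=> e0 fg; apply: ge_inf; [case: (d_sk_has_inf f g)|]. Qed.

Lemma d_sk_ge0 f g : 0 <= d_sk f g.
Proof. by apply: lb_le_inf; [case: (d_sk_has_inf f g)|move=> e [/ltW]]. Qed.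

Lemma d_skxx f : d_sk f f = 0.
Proof.
apply/eqP; rewrite eq_le d_sk_ge0 andbT; apply/ler_addgt0Pl => e e0.
by rewrite addr0; apply: d_sk_le => //; apply: sk_close_norm; rewrite subrr normr0.
Qed.

Lemma d_sk_sym f g : d_sk f g = d_sk g f.
Proof.
rewrite /d_sk; congr inf; apply/seteqP.
by split => e [e0 /sk_close_sym].
Qed.

Lemma d_sk_triangle g f h : d_sk f h <= d_sk f g + d_sk g h.
Proof.
apply/ler_addgt0Pl => e e0.
have /d_sk_lt[fg0 fg] : d_sk f g < d_sk f g + e / 2 by rewrite ltrDl divr_gt0.
have /d_sk_lt[gh0 gh] : d_sk g h < d_sk g h + e / 2 by rewrite ltrDl divr_gt0.
rewrite [leRHS](_ : _ = (d_sk f g + e / 2) + (d_sk g h + e / 2)).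
  by apply: d_sk_le; [rewrite addr_gt0|exact: sk_close_trans gh].
by rewrite addrACA -splitr addrC.
Qed.

Lemma d_sk_positivity f g : d_sk f g = 0 -> f = g.
Proof.
move=> fg0; have fg e : 0 < e -> sk_close f g e.
  by move=> e0; have /d_sk_lt[] : d_sk f g < e by rewrite fg0.
have [f0 fr _] := d01P f; have [g0 gr _] := d01P g.
apply/val_inj/funext => t /=.
have [t01|t01] := boolP (t \in `[0, 1]); last by rewrite f0// g0.
apply/eqP; rewrite -subr_eq0 -normr_le0; apply/ler_addgt0Pl => e e0.
rewrite addr0; have e30 : 0 < e / 3 by rewrite divr_gt0.
move: (t01); rewrite in_itv/= => /andP[t0].
rewrite le_eqVlt => /predU1P[t1|t1].
  have [tau [[tf _ ts] th] /(_ _ t01)[fgt _]] := fg _ e0.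
  have tau1 : tau t = t.
    have [x] := ts t t01; rewrite /= in_itv/= => /andP[x0 x1] xt.
    move: x1; rewrite le_eqVlt => /predU1P[x1|x1].
      by move: xt; rewrite x1 -t1.
    have xt1 : x < t by rewrite t1.
    have x01 : x \in `[0, 1] by rewrite in_itv/= x0 ltW.
    have /= := th _ _ x01 t01 xt1; rewrite xt {1}t1 ltNge.
    by have /= := tf _ t01; rewrite in_itv/= => /andP[_ ->].
  by move: fgt; rewrite tau1 => /ltW.
have [d /= d0 dfg] : \forall u \near t^'+,
    [/\ `|f t - f u| < e / 3, `|g t - g u| < e / 3 & u < 1].
  have t01' : 0 <= t < 1 by rewrite t0.
  have /cvgrPdist_lt/(_ _ e30) H1 := fr _ t01'.
  have /cvgrPdist_lt/(_ _ e30) H2 := gr _ t01'.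
  have H3 := nbhs_right_lt t1.
  by near=> u; split; near: u.
pose u := t + d / 2.
have d4 : 0 < d / 4 by rewrite divr_gt0.
have tu : t < u by rewrite ltrDl divr_gt0.
have [|fu _ u1] := dfg u _ tu.
  by rewrite /= /u opprD addrA subrr sub0r normrN gtr0_norm ?divr_gt0// ltr_pdivrMr// ltr_pMr// ltr1n.
have u01 : u \in `[0, 1] by rewrite in_itv/= (le_trans t0 (ltW tu)) ltW.
have me : 0 < Num.min (e / 3) (d / 4) by rewrite lt_min e30.
have [tau tt /(_ _ u01)[]] := fg _ me.
rewrite !lt_min => /andP[fgu _] /andP[_]; rewrite ltr_distl => /andP[tu1 tu2].
have [||_ gu _] := dfg (tau u).
- by rewrite /= distrC ltr_distl; move: tu1 tu2 d0; rewrite /u; lra.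
- by move: tu1 d0; rewrite /u; lra.
move: fu gu fgu; rewrite !ltr_norml ler_norml; lra.
Unshelve. all: by end_near. Qed.

End skorokhod.

(* D01 R carries the sup norm; Dsk R is the same type with the metric d_sk. *)
Definition Dsk (R : realType) := D01 R.

HB.instance Definition _ (R : realType) := Choice.on (Dsk R).
HB.instance Definition _ (R : realType) := isPointed.Build (Dsk R) (0 : D01 R).
HB.instance Definition _ (R : realType) := isMetric.Build R (Dsk R)
  (@d_skxx R) (@d_sk_positivity R) (@d_sk_sym R) (@d_sk_triangle R).
HB.instance Definition _ (R : realType) :=
  Measurable.copy (Dsk R) (g_sigma_algebraType (@open (Dsk R))).

Section piecewise_paths.
Context {R : realType}.

Definition mesh_ge (r : R) (l : nat) (t : nat -> R) :=
  [/\ t 0%N = 0, t l = 1 &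
      forall i, (i < l)%N -> t i < t i.+1 /\ r <= `|t i.+1 - t i|].

Definition C01_piecewise (r : R) : set (C01 R) := [set f : C01 R |
  exists l t, mesh_ge r l t /\ forall i, (i < l)%N ->
    exists a b, forall u, u \in `[t i, t i.+1] -> f u = a * u + b].

Definition D01_piecewise (r : R) : set (D01 R) := [set f : D01 R |
  (exists l t, mesh_ge r l t /\ forall i, (i < l)%N ->
    exists c, forall u, u \in `[t i, t i.+1[ -> f u = c) /\
  f u @[u --> 1^'-] --> f 1].

End piecewise_paths.

Section higher_frechet.
Context {R : realType} {B : normedModType R}.

Definition mlform k := {ptws 'I_k -> B} -> R.

Definition subst_arg k (h : 'I_k -> B) i (u : B) : 'I_k -> B :=
  fun j => if j == i then u else h j.

Definition multilinear k (g : mlform k) :=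
  forall h i (a : R) (u v : B),
    g (subst_arg h i (a *: u + v)) =
    a * g (subst_arg h i u) + g (subst_arg h i v).

Definition form_norm k (g : mlform k) : \bar R :=
  ereal_sup [set `|g h|%:E | h in [set h | forall i, `|h i| <= 1]].

Definition cons_arg k (u : B) (h : 'I_k -> B) : 'I_k.+1 -> B :=
  fun i => oapp h u (unlift ord0 i).

(* D k is the k-th Frechet derivative of f for k <= m, where the derivative at
   x of D k, a continuous linear map from B to k-linear forms, is identified
   with the (k+1)-linear form (u, h) |-> (D(D k)(x) u)(h). *)
Definition frechet_derivatives m (f : B -> R) (D : forall k, B -> mlform k) :=
  [/\ forall x h, D 0%N x h = f x,
      forall k x, (k <= m)%N -> multilinear (D k x) /\ continuous (D k x) &
      forall k x (e : R), (k < m)%N -> 0 < e -> \forall u \near (0 : B),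
        (form_norm (fun h => (D k (x + u) h - D k x h
                              - D k.+1 x (cons_arg u h))%R)
         <= (e * `|u|)%:E)%E].

Definition form_continuous k (D : B -> mlform k) :=
  forall x (e : R), 0 < e -> \forall y \near x,
    (form_norm (fun h => (D y h - D x h)%R) <= e%:E)%E.

Definition zol_order (s : R) : nat := `|Num.ceil s|%N.-1.

Definition zol_class (s : R) : set (B -> R) := [set f |
  exists D, [/\ frechet_derivatives (zol_order s) f D,
    form_continuous (D (zol_order s)) &
    forall x y, (form_norm (fun h => (D (zol_order s) x h
                                      - D (zol_order s) y h)%R)
                 <= (`|x - y| `^ (s - (zol_order s)%:R))%:E)%E]].

End higher_frechet.

Section random_paths.
Context {d} {T : measurableType d} {R : realType} (P : probability T R).

(* If f(X) - f(Y) fails to be integrable for some f in F, its expectation is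
   infinite and so is the supremum. *)
Definition zol_dist (S : Type) (F : set (S -> R)) (X Y : T -> S) : \bar R :=
  ereal_sup [set (`|'E_P[fun w => (f (X w) - f (Y w))%R]|)%E | f in F].

Definition zeta_C (s : R) (X Y : T -> C01 R) : \bar R :=
  zol_dist (zol_class s) X Y.

Definition zeta_D (s : R) (X Y : T -> Dsk R) : \bar R :=
  zol_dist (zol_class (B := D01 R) s `&`
            [set f | measurable_fun setT (f : Dsk R -> R)]) X Y.

Definition cvg_in_distribution (S : topologicalType)
    (X_ : nat -> T -> S) (X : T -> S) :=
  forall phi : S -> R, continuous phi -> bounded_fun phi ->
    ('E_P[fun w => phi (X_ n w)] @[n --> \oo] --> 'E_P[fun w => phi (X w)])%E.

End random_paths.

(* z n = o(log^{-m}(1 / r n)) as n -> oo, multiplied out.  The rate is read as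
   a bounded one, so that the relation entails z n = o(1): the first conjunct
   follows from the second when r n is bounded away from 1, but not when r n
   accumulates at 1, where log^{-m}(1 / r n) blows up if m > 0. *)
Definition little_o_log {R : realType} (z : nat -> \bar R) (r : nat -> R)
    (m : nat) : Prop :=
  (z n @[n --> \oo] --> 0%E) /\
  ((z n * (ln (1 / r n) ^+ m)%:E)%E @[n --> \oo] --> 0%E).

(* Main.v *)
(* A sup-norm ball around x is, up to a small error, the set where the maximum
   of |f - x| over a finite grid is small.  For f piecewise affine (or constant)
   with mesh r and x continuous, a grid of size O(1 / r) suffices: where |f - x|
   exceeds b, it exceeds b - g on an interval of length proportional to r.  A
   finite union of balls is therefore separated from the complement of a slightly
   larger one by the smooth function sigmoid (L / p * ln (sum_i 1 / Z_i)), where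
   Z_i is the sum over the grid of exp (p (|f - x_i| - b_i)), as soon as p is a
   large multiple of ln (1 / r).  The k-th derivative of this function is
   O(p^(k-1)) uniformly in the grid, so that dividing it by a multiple of p^m
   yields an element of the Zolotarev class; the rate of zeta_s compensates for
   this factor.  Since C[0, 1] is separable, an open set is exhausted, on the
   continuous paths, by such finite unions of balls; this gives
   liminf P(X_n in O) >= P(X in O) and hence the convergence in distribution. *)
Require Import Defs.
From HB Require Import structures.
From mathcomp Require Import all_boot all_order all_algebra.
From mathcomp Require Import all_classical all_reals all_analysis.
From mathcomp Require Import measurable_realfun ring lra.

Set Implicit Arguments.
Unset Strict Implicit.
Unset Printing Implicit Defensive.

Import Order.TTheory GRing.Theory Num.Theory.
Import numFieldNormedType.Exports.

Local Open Scope classical_set_scope.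
Local Open Scope ring_scope.

(** * Functions with controlled derivatives *)

(** The bound O(p^(k-1)) is free of the grid because every layer of the construction is homogeneous.
    A sum Z of exponentials has k-th derivatives of size p^k Z, its inverse p^k / Z, the sum W of
    the inverses p^k W; the logarithm divides W out and leaves p^k. Composing with z |-> sigmoid (L
    z / p) gains the factor 1 / p. The numbers of balls and grid points enter only through the error
    of the soft maximum and minimum, which is their logarithm over p; hence p of order ln (1 / r).
    After the division by a multiple of p^m the m-th derivative has oscillation and Lipschitz
    constant at most 1, and min (1, t) <= t^alpha yields the Hoelder condition for every alpha in
    (0, 1]. The argument runs once, for a normed space B with evaluations [ev]; the Skorokhod
    topology enters only through measurability and through its open sets being open for the sup
    norm. *)

Section jets.
Context {R : realType} {B : normedModType R}.
Implicit Types (f U : B -> R) (x v : B).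

(** Restriction to a line makes the one-dimensional chain rule and mean value theorem available for
    directional derivatives. *)
Lemma is_derive_line f x v (df : R) :
  is_derive (0 : R) 1 (fun t : R => f (t *: v + x)) df <-> is_derive x v f df.
Proof.
have E : (fun h : R => h^-1 *: (f ((h *: (1 : R) + 0 : R) *: v + x)
                                  - f ((0 : R) *: v + x))) =
         (fun h => h^-1 *: (f (h *: v + x) - f x)).
  by apply/funext => h; rewrite scale0r add0r addr0 /GRing.scale /= mulr1.
split=> -[d1 d2]; split.
- by move: d1; rewrite /derivable /= E.
- by move: d2; rewrite /derive /= E.
- by rewrite /derivable /= E.
- by rewrite /derive /= E.
Qed.

Lemma is_derive_line_at f x v (df : R) (t : R) :
  is_derive (t *: v + x) v f df ->
  is_derive t 1 (fun t : R => f (t *: v + x)) df.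
Proof.
move=> /is_derive_line fd.
have -> : (fun t : R => f (t *: v + x)) =
    (fun s : R => f (s *: v + (t *: v + x))) \o (fun s => s - t).
  by apply/funext => s /=; rewrite addrA -scalerDl subrK.
rewrite -[df]mulr1; apply: is_derive1_comp; first by rewrite subrr.
by apply: is_derive_eq; rewrite subr0.
Qed.

Lemma is_derive_comp_line (g : R -> R) f x v (dg df : R) :
  is_derive (f x) 1 g dg -> is_derive x v f df ->
  is_derive x v (g \o f) (dg * df).
Proof.
move=> gd /is_derive_line fd; apply/is_derive_line.
have := @is_derive1_comp _ g (fun t => f (t *: v + x)) 0 dg df.
by rewrite scale0r add0r; apply.
Qed.

Lemma mean_value_bound f (f1 : B -> R) x v (K : R) :
  (forall y, is_derive y v f (f1 y)) -> (forall y, `|f1 y| <= K) ->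
  `|f (x + v) - f x| <= K.
Proof.
move=> fd fK.
have [c _] := @MVT_segment R (fun t => f (t *: v + x))
  (fun t => f1 (t *: v + x)) 0 1 ler01
  (fun t _ => is_derive_line_at (fd (t *: v + x)))
  (derivable_within_continuous
    (fun t _ => @ex_derive _ _ _ _ _ _ _ (is_derive_line_at (fd (t *: v + x))))).
by rewrite scale1r scale0r add0r subr0 mulr1 [x + v]addrC => ->.
Qed.

(** Two mean value theorems in a row replace Taylor's formula; the lost factor 1/2 is harmless. *)
Lemma mean_value_bound2 f (f1 : B -> R) (f2 : B -> R) x v (K : R) :
  (forall y, is_derive y v f (f1 y)) ->
  (forall y, is_derive y v f1 (f2 y)) -> (forall y, `|f2 y| <= K) ->
  `|f (x + v) - f x - f1 x| <= K.
Proof.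
move=> fd f1d f2K.
have [c] := @MVT_segment R (fun t => f (t *: v + x))
  (fun t => f1 (t *: v + x)) 0 1 ler01
  (fun t _ => is_derive_line_at (fd (t *: v + x)))
  (derivable_within_continuous
    (fun t _ => @ex_derive _ _ _ _ _ _ _ (is_derive_line_at (fd (t *: v + x))))).
rewrite scale1r scale0r add0r subr0 mulr1 [x + v]addrC => c01 ->.
have K0 : 0 <= K by exact: le_trans (normr_ge0 _) (f2K x).
have [c0 c1] : 0 <= c /\ c <= 1 by move: c01; rewrite in_itv => /andP.
have [e] := @MVT_segment R (fun t => f1 (t *: v + x))
  (fun t => f2 (t *: v + x)) 0 c c0
  (fun t _ => is_derive_line_at (f1d (t *: v + x)))
  (derivable_within_continuous
    (fun t _ => @ex_derive _ _ _ _ _ _ _ (is_derive_line_at (f1d (t *: v + x))))).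
rewrite scale0r add0r subr0 => _ ->; rewrite normrM (ger0_norm c0).
by rewrite -[leRHS]mulr1 ler_pM.
Qed.

(* The weight w makes the estimates uniform in the number of linear functionals
   from which f is built: a sum of exponentials exp(p l_j) is its own weight. *)
Record jet (p : R) (w f : B -> R) (f1 : B -> B -> R) (f2 : B -> B -> B -> R)
    (f3 : B -> B -> B -> B -> R) : Prop := Jet {
  jet_d1 : forall x v, is_derive x v f (f1 x v) ;
  jet_d2 : forall x v h, is_derive x v (f1 ^~ h) (f2 x v h) ;
  jet_d3 : forall x v g h, is_derive x v (fun y => f2 y g h) (f3 x v g h) ;
  jet_l1 : forall x a u v, f1 x (a *: u + v) = a * f1 x u + f1 x v ;
  jet_l2l : forall x a u v h, f2 x (a *: u + v) h = a * f2 x u h + f2 x v h ;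
  jet_l2r : forall x a u v h, f2 x h (a *: u + v) = a * f2 x h u + f2 x h v ;
  jet_b1 : forall x h, `|f1 x h| <= p * w x * `|h| ;
  jet_b2 : forall x g h, `|f2 x g h| <= p ^+ 2 * w x * (`|g| * `|h|) ;
  jet_b3 : forall x v g h,
    `|f3 x v g h| <= p ^+ 3 * w x * (`|v| * (`|g| * `|h|)) }.

Definition has_jet p w f := exists (f1 : B -> B -> R) (f2 : B -> B -> B -> R)
  (f3 : B -> B -> B -> B -> R), jet p w f f1 f2 f3.

Lemma has_jet_affine p (l : B -> R) b : 0 <= p ->
  (forall a u v, l (a *: u + v) = a * l u + l v) -> (forall u, `|l u| <= `|u|) ->
  has_jet p (cst 1) (fun x => p * (l x - b)).
Proof.
move=> p0 llin lb; exists (fun _ v => p * l v), (fun _ _ _ => 0), (fun _ _ _ _ => 0).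
have l0 : l 0 = 0 by apply/eqP; rewrite -normr_le0 (le_trans (lb _)) ?normr0.
split=> //=.
- move=> x v; apply/is_derive_line.
  have -> : (fun t : R => p * (l (t *: v + x) - b)) =
            (fun t : R => (p * l v) * t + p * (l x - b)).
    by apply/funext => t; rewrite llin; ring.
  apply: is_derive_eq; rewrite /GRing.scale/=; ring.
- by move=> x v h; exact: is_derive_cst.
- by move=> x v h g; exact: is_derive_cst.
- by move=> x a u v; rewrite llin; ring.
- by move=> *; ring.
- by move=> *; ring.
- by move=> x h; rewrite mulr1 normrM ger0_norm// ler_wpM2l.
- by move=> *; rewrite normr0 !mulr_ge0// ?exprn_ge0.
- by move=> *; rewrite normr0 !mulr_ge0// ?exprn_ge0.
Qed.

Lemma has_jet_cst0 p : has_jet p (cst 0) (cst 0).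
Proof.
exists (fun _ _ => 0), (fun _ _ _ => 0), (fun _ _ _ _ => 0).
by split=> /= *; rewrite ?normr0 ?(mulr0, mul0r, addr0) //; exact: is_derive_cst.
Qed.

Lemma has_jetD p w f w' f' : has_jet p w f -> has_jet p w' f' ->
  has_jet p (w + w') (f + f').
Proof.
move=> [f1 [f2 [f3 [d1 d2 d3 l1 l2l l2r b1 b2 b3]]]].
move=> [g1 [g2 [g3 [d1' d2' d3' l1' l2l' l2r' b1' b2' b3']]]].
exists (fun x v => f1 x v + g1 x v), (fun x v h => f2 x v h + g2 x v h),
  (fun x v g h => f3 x v g h + g3 x v g h); split.
- by move=> x v; exact: is_deriveD.
- by move=> x v h; exact: (is_deriveD (d2 x v h) (d2' x v h)).
- by move=> x v g h; exact: (is_deriveD (d3 x v g h) (d3' x v g h)).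
- by move=> x a u v; rewrite l1 l1'; ring.
- by move=> x a u v h; rewrite l2l l2l'; ring.
- by move=> x a u v h; rewrite l2r l2r'; ring.
- by move=> x h; rewrite fctE mulrDr mulrDl (le_trans (ler_normD _ _))// lerD.
- by move=> x g h; rewrite fctE mulrDr mulrDl (le_trans (ler_normD _ _))// lerD.
- by move=> x v g h; rewrite fctE mulrDr mulrDl (le_trans (ler_normD _ _))// lerD.
Qed.

(** The weights add up like the functions, so no constant depends on the number of summands. *)
Lemma has_jet_sum (I : Type) (s : seq I) p (w f : I -> B -> R) :
  (forall i, has_jet p (w i) (f i)) ->
  has_jet p (fun x => \sum_(i <- s) w i x) (fun x => \sum_(i <- s) f i x).
Proof.
move=> wf; elim: s => [|i s IH].
  rewrite (_ : (fun x => _) = cst 0); last by apply/funext => x; rewrite big_nil.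
  rewrite [X in has_jet _ _ X](_ : _ = cst 0); last first.
    by apply/funext => x; rewrite big_nil.
  exact: has_jet_cst0.
rewrite (_ : (fun x => _) = w i + (fun x => \sum_(i <- s) w i x)); last first.
  by apply/funext => x; rewrite big_cons.
rewrite [X in has_jet _ _ X](_ : _ = f i + (fun x => \sum_(i <- s) f i x)); last first.
  by apply/funext => x; rewrite big_cons.
exact: has_jetD.
Qed.

Lemma normrM_le (a b c d : R) : `|a| <= c -> `|b| <= d -> `|a * b| <= c * d.
Proof. by move=> ac bd; rewrite normrM ler_pM. Qed.

(* The constant 5 counts the terms of the third derivative of g \o U. *)
Lemma has_jet_comp p (u A U : B -> R) (g g1 g2 g3 : R -> R) :
  0 <= p -> (forall x, 0 <= u x) -> has_jet p u U ->
  (forall x, is_derive (U x) 1 g (g1 (U x))) ->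
  (forall x, is_derive (U x) 1 g1 (g2 (U x))) ->
  (forall x, is_derive (U x) 1 g2 (g3 (U x))) ->
  (forall x, `|g1 (U x)| * u x <= A x) ->
  (forall x, `|g2 (U x)| * u x ^+ 2 <= A x) ->
  (forall x, `|g3 (U x)| * u x ^+ 3 <= A x) ->
  has_jet p (fun x => 5 * A x) (g \o U).
Proof.
move=> p0 u0 [U1 [U2 [U3 [d1 d2 d3 l1 l2l l2r b1 b2 b3]]]] gd g1d g2d A1 A2 A3.
have g1U x v := is_derive_comp_line (g1d x) (d1 x v).
have g2U x v := is_derive_comp_line (g2d x) (d1 x v).
have A0 x : 0 <= A x by apply: le_trans (A1 x); rewrite mulr_ge0.
exists (fun x v => g1 (U x) * U1 x v),
  (fun x v h => g2 (U x) * (U1 x v * U1 x h) + g1 (U x) * U2 x v h),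
  (fun x v e h => g3 (U x) * (U1 x v * (U1 x e * U1 x h))
     + g2 (U x) * (U2 x v e * U1 x h + U1 x e * U2 x v h)
     + g2 (U x) * (U1 x v * U2 x e h) + g1 (U x) * U3 x v e h); split.
- by move=> x v; exact: is_derive_comp_line.
- move=> x v h; apply: (@is_derive_eq _ _ _ _ _ _ _ _
    (is_deriveM (g1U x v) (d2 x v h))).
  by rewrite ?fctE /GRing.scale/=; ring.
- move=> x v e h; apply: (@is_derive_eq _ _ _ _ _ _ _ _ (is_deriveD
    (is_deriveM (g2U x v) (is_deriveM (d2 x v e) (d2 x v h)))
    (is_deriveM (g1U x v) (d3 x v e h)))).
  by rewrite ?fctE /GRing.scale/=; ring.
- by move=> x a e v; rewrite l1; ring.
- by move=> x a e v h; rewrite l1 l2l; ring.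
- by move=> x a e v h; rewrite l1 l2r; ring.
- move=> x h; rewrite normrM.
  apply: (@le_trans _ _ (p * `|h| * (`|g1 (U x)| * u x))).
    by rewrite [leRHS](_ : _ = `|g1 (U x)| * (p * u x * `|h|)) ?ler_wpM2l//; ring.
  rewrite [leRHS](_ : _ = p * `|h| * (5 * A x)); last by ring.
  by rewrite ler_wpM2l ?mulr_ge0// (le_trans (A1 x))// ler_peMl// ler1n.
- move=> x e h.
  rewrite [leRHS](_ : _ = p ^+ 2 * (`|e| * `|h|) * (5 * A x)); last by ring.
  have pe0 : 0 <= p ^+ 2 * (`|e| * `|h|) by rewrite !mulr_ge0 ?exprn_ge0.
  apply: (@le_trans _ _ (p ^+ 2 * (`|e| * `|h|) *
      (`|g2 (U x)| * u x ^+ 2 + `|g1 (U x)| * u x))); last first.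
    by rewrite ler_wpM2l//; have := A1 x; have := A2 x; have := A0 x; lra.
  rewrite (le_trans (ler_normD _ _))//.
  rewrite [leRHS](_ : _ = `|g2 (U x)| * ((p * u x * `|e|) * (p * u x * `|h|))
    + `|g1 (U x)| * (p ^+ 2 * u x * (`|e| * `|h|))); last by ring.
  by rewrite lerD// normrM ler_wpM2l// normrM_le.
- move=> x v e h.
  rewrite [leRHS](_ : _ = p ^+ 3 * (`|v| * (`|e| * `|h|)) * (5 * A x)); last by ring.
  have pe0 : 0 <= p ^+ 3 * (`|v| * (`|e| * `|h|)) by rewrite !mulr_ge0 ?exprn_ge0.
  (* The 3 counts the products of a first and a second derivative of U. *)
  apply: (@le_trans _ _ (p ^+ 3 * (`|v| * (`|e| * `|h|)) *
      (`|g3 (U x)| * u x ^+ 3 + 3 * (`|g2 (U x)| * u x ^+ 2) + `|g1 (U x)| * u x)));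
    last first.
    by rewrite ler_wpM2l//; have := A1 x; have := A2 x; have := A3 x; lra.
  pose q1 (a : B) := p * u x * `|a|; pose q2 (a b : B) := p ^+ 2 * u x * (`|a| * `|b|).
  rewrite [leRHS](_ : _ = `|g3 (U x)| * (q1 v * (q1 e * q1 h))
    + `|g2 (U x)| * (q2 v e * q1 h + q1 e * q2 v h)
    + `|g2 (U x)| * (q1 v * q2 e h)
    + `|g1 (U x)| * (p ^+ 3 * u x * (`|v| * (`|e| * `|h|)))); last first.
    by rewrite /q1 /q2; ring.
  apply: le_trans (ler_normD _ _) _; apply: lerD; last first.
    by rewrite normrM ler_wpM2l.
  apply: le_trans (ler_normD _ _) _; apply: lerD; last first.
    by rewrite normrM ler_wpM2l// normrM_le.
  apply: le_trans (ler_normD _ _) _; apply: lerD.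
    by rewrite normrM ler_wpM2l// !normrM_le.
  rewrite normrM ler_wpM2l//; apply: le_trans (ler_normD _ _) _.
  by apply: lerD; rewrite normrM_le.
Qed.

End jets.

(** * From derivative bounds to the Zolotarev class *)

Section jet_zolotarev.
Context {R : realType} {B : normedModType R}.
Implicit Types (x v : B).

Lemma has_jetZ p (c : R) (w f : B -> R) : has_jet p w f ->
  has_jet p (fun x => `|c| * w x) (fun x => c * f x).
Proof.
move=> [f1 [f2 [f3 [d1 d2 d3 l1 l2l l2r b1 b2 b3]]]].
exists (fun x v => c * f1 x v), (fun x v h => c * f2 x v h),
  (fun x v g h => c * f3 x v g h); split.
- by move=> x v; exact: (is_deriveZ c (d1 x v)).
- by move=> x v h; exact: (is_deriveZ c (d2 x v h)).
- by move=> x v g h; exact: (is_deriveZ c (d3 x v g h)).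
- by move=> x a u v; rewrite l1; ring.
- by move=> x a u v h; rewrite l2l; ring.
- by move=> x a u v h; rewrite l2r; ring.
- by move=> x h; rewrite normrM [leRHS](_ : _ = `|c| * (p * w x * `|h|)) ?ler_wpM2l//; ring.
- move=> x g h; rewrite normrM.
  by rewrite [leRHS](_ : _ = `|c| * (p ^+ 2 * w x * (`|g| * `|h|))) ?ler_wpM2l//; ring.
- move=> x v g h; rewrite normrM.
  rewrite [leRHS](_ : _ = `|c| * (p ^+ 3 * w x * (`|v| * (`|g| * `|h|)))); last by ring.
  by rewrite ler_wpM2l.
Qed.

Lemma form_norm_le k (g : @mlform R B k) (K : R) :
  (forall h, (forall i, `|h i| <= 1) -> `|g h| <= K) -> (form_norm g <= K%:E)%E.
Proof.
by move=> gK; apply: ge_ereal_sup => _ [h hi <-]; rewrite lee_fin; exact: gK.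
Qed.

(** Interpolates between a bounded and a Lipschitz estimate, which gives the Hoelder condition of
    fractional order. *)
Lemma min1_powR (t a : R) : 0 <= t -> 0 < a -> a <= 1 -> Num.min 1 t <= t `^ a.
Proof.
move=> t0 a0 a1; rewrite ge_min; have [t1|t1] := lerP 1 t.
  by rewrite -{1}(powRr0 t) ler_powR// ltW.
have [->|tn0] := eqVneq t 0.
  by rewrite powR_ge0 orbT.
by rewrite ger1_powR ?orbT// lt_neqAle eq_sym tn0 t0 ltW.
Qed.

Lemma form_norm_frechet k (D : B -> @mlform R B k)
    (G : B -> B -> @mlform R B k) (K e : R) x : 0 <= K -> 0 < e ->
  (forall u h, (forall i, `|h i| <= 1) ->
    `|D (x + u) h - D x h - G x u h| <= K * `|u| ^+ 2) ->
  \forall u \near (0 : B),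
    (form_norm (fun h => (D (x + u) h - D x h - G x u h)%R) <= (e * `|u|)%:E)%E.
Proof.
move=> K0 e0 DK.
(* K + 1 rather than K, as K may be 0. *)
have : \forall u \near (0 : B), `|u| < e / (K + 1).
  by apply: nbhs0_lt; rewrite divr_gt0// ltr_wpDl.
apply: filterS => u; rewrite ltr_pdivlMr ?ltr_wpDl// => ue.
apply: form_norm_le => h h1; rewrite (le_trans (DK u h h1))// expr2 mulrA.
rewrite ler_wpM2r// (le_trans _ (ltW ue))// mulrC ler_wpM2l// lerDl//.
Qed.

Lemma form_norm_hoelder k (D : B -> @mlform R B k) (C K a : R) :
  0 < a -> a <= 1 -> C <= 1 -> K <= 1 ->
  (forall x y h, (forall i, `|h i| <= 1) -> `|D x h - D y h| <= C) ->
  (forall x y h, (forall i, `|h i| <= 1) -> `|D x h - D y h| <= K * `|x - y|) ->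
  form_continuous D /\ forall x y,
    (form_norm (fun h => (D x h - D y h)%R) <= (`|x - y| `^ a)%:E)%E.
Proof.
move=> a0 a1 C1 K1 DC DK.
have DK' x y h : (forall i, `|h i| <= 1) -> `|D x h - D y h| <= `|x - y|.
  by move=> h1; rewrite (le_trans (DK _ _ _ h1))// ler_piMl.
split=> [x e e0|x y].
  have : \forall y \near x, `|x - y| < e by exact: cvgr_dist_lt.
  apply: filterS => y xy; apply: form_norm_le => h h1.
  by rewrite (le_trans (DK' _ _ _ h1))// distrC ltW.
apply: form_norm_le => h h1; rewrite (le_trans _ (min1_powR _ a0 a1))//.
by rewrite le_min (le_trans (DC _ _ _ h1))//= DK'.
Qed.

Lemma bounded_linear_continuous (K : R) (g : B -> R) : 0 <= K ->
  (forall c u v, g (c *: u + v) = c * g u + g v) ->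
  (forall h, `|g h| <= K * `|h|) -> continuous g.
Proof.
move=> K0 gl gb h; apply/cvgrPdist_lt => e e0.
have : \forall y \near h, `|h - y| < e / (K + 1).
  by apply: cvgr_dist_lt => //; rewrite divr_gt0// ltr_wpDl.
apply: filterS => y; rewrite ltr_pdivlMr ?ltr_wpDl// => hy.
have -> : g h - g y = g (h - y) by rewrite -[h - y]addrC -(scaleN1r y) gl; ring.
by rewrite (le_lt_trans (gb _))// (le_lt_trans _ hy)// mulrC ler_wpM2l// lerDl.
Qed.

Lemma bilinear_cvg (K : R) (g : B -> B -> R) (T : Type) (F : set_system T)
    (FF : Filter F) (u v : T -> B) (u0 v0 : B) :
  0 <= K -> (forall c u v h, g (c *: u + v) h = c * g u h + g v h) ->
  (forall c u v h, g h (c *: u + v) = c * g h u + g h v) ->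
  (forall u v, `|g u v| <= K * (`|u| * `|v|)) ->
  u @ F --> u0 -> v @ F --> v0 -> (fun t => g (u t) (v t)) @ F --> g u0 v0.
Proof.
move=> K0 gl gr gb uu vv; apply/cvgrPdist_lt => e e0.
(* The two halves of the difference carry the factors K |v0| and K (|u0| + 1). *)
pose M := K * (`|u0| + `|v0| + 1).
have M0 : 0 <= M by rewrite mulr_ge0// !addr_ge0.
pose r := Num.min 1 (e / (M + 1)).
have r0 : 0 < r by rewrite lt_min ltr01 divr_gt0// ltr_wpDl.
have nu : \forall t \near F, `|u0 - u t| < r by apply: cvgr_dist_lt.
have nv : \forall t \near F, `|v0 - v t| < r by apply: cvgr_dist_lt.
apply: filterS2 nu nv => t /ltW ut /ltW vt.
have -> : g u0 v0 - g (u t) (v t) = g (u0 - u t) v0 + g (u t) (v0 - v t).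
  rewrite -[u0 - u t]addrC -[v0 - v t]addrC.
  rewrite -(scaleN1r (u t)) -(scaleN1r (v t)) gl gr; ring.
have ut0 : `|u t| <= `|u0| + 1.
  rewrite -(subKr u0 (u t)) (le_trans (ler_normB _ _))// lerD2l.
  by rewrite (le_trans ut)// ge_min lexx.
apply: (@le_lt_trans _ _ (M * r)).
  rewrite [leRHS](_ : _ = K * (r * `|v0|) + K * ((`|u0| + 1) * r)); last first.
    by rewrite /M; ring.
  apply: le_trans (ler_normD _ _) _; apply: lerD.
    by rewrite (le_trans (gb _ _))// ler_wpM2l// ler_wpM2r.
  by rewrite (le_trans (gb _ _))// ler_wpM2l// ler_pM.
apply: (@le_lt_trans _ _ (M * (e / (M + 1)))).
  by rewrite ler_wpM2l// ge_min lexx orbT.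
by rewrite mulrA ltr_pdivrMr ?ltr_wpDl// mulrC ltr_pM2l// ltrDl.
Qed.

(** Three derivatives suffice as m <= 2: the one of order m + 1 bounds the Lipschitz constant of
    [D m], and for k < m the one of order k + 2 bounds the remainder of [D k] quadratically. *)
Lemma jet_zol_class (s p a : R) f (f1 : B -> B -> R) (f2 : B -> B -> B -> R)
    (f3 : B -> B -> B -> B -> R) :
  (zol_order s <= 2)%N -> 0 < s - (zol_order s)%:R ->
  s - (zol_order s)%:R <= 1 -> 1 <= p -> 0 <= a ->
  2 * p ^+ (zol_order s).+1 * a <= 1 -> (forall x, `|f x| <= 2^-1) ->
  jet p (cst a) f f1 f2 f3 -> zol_class s f.
Proof.
rewrite /zol_class /=; move: (zol_order s) => m m2 sm0 sm1 p1 a0 pa fh.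
move=> [d1 d2 d3 l1 l2l l2r b1 b2 b3].
have p0 : 0 <= p by exact: le_trans p1.
pose i0 : 'I_2 := ord0; pose i1 : 'I_2 := lift ord0 ord0.
(* The value 0 only fills orders above 2, hence above m. *)
pose D k : B -> @mlform R B k := match k with
  | 0 => fun x _ => f x
  | 1 => fun x h => f1 x (h ord0)
  | 2 => fun x h => f2 x (h i0) (h i1)
  | _ => fun _ _ => 0 end.
have pX k l : (k <= l)%N -> p ^+ k <= p ^+ l by move=> kl; exact: ler_weXn2l.
have h1M (h g : B) : `|h| <= 1 -> `|g| <= 1 -> `|h| * `|g| <= 1.
  by move=> h1 g1; rewrite mulr_ile1.
have lip0 x y h : `|D 0 x h - D 0 y h| <= p * a * `|x - y|.
  have := @mean_value_bound _ _ f (f1 ^~ (x - y)) y (x - y)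
    (p * a * `|x - y|) (fun z => d1 z _) (fun z => b1 z (x - y)).
  by rewrite subrKC.
have lip1 x y h : (forall i, `|h i| <= 1) ->
    `|D 1 x h - D 1 y h| <= p ^+ 2 * a * `|x - y|.
  move=> h1; have := @mean_value_bound _ _ (f1 ^~ (h ord0))
    (fun z => f2 z (x - y) (h ord0)) y (x - y) (p ^+ 2 * a * `|x - y|)
    (fun z => d2 z (x - y) (h ord0)).
  rewrite subrKC; apply => z.
  rewrite (le_trans (b2 _ _ _))// ler_wpM2l ?mulr_ge0 ?exprn_ge0//.
  by rewrite ler_piMr.
have lip2 x y h : (forall i, `|h i| <= 1) ->
    `|D 2 x h - D 2 y h| <= p ^+ 3 * a * `|x - y|.
  move=> h1; have := @mean_value_bound _ _ (fun z => f2 z (h i0) (h i1))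
    (fun z => f3 z (x - y) (h i0) (h i1)) y (x - y) (p ^+ 3 * a * `|x - y|)
    (fun z => d3 z (x - y) (h i0) (h i1)).
  rewrite subrKC; apply => z.
  rewrite (le_trans (b3 _ _ _ _))// ler_wpM2l ?mulr_ge0 ?exprn_ge0//.
  by rewrite ler_piMr// h1M.
have lip k x y h : (k <= 2)%N -> (forall i, `|h i| <= 1) ->
    `|D k x h - D k y h| <= p ^+ k.+1 * a * `|x - y|.
  by case: k h => [|[|[|//]]] h _ h1; [exact: lip0|exact: lip1|exact: lip2].
have cont1 x : continuous (f1 x).
  by apply: (@bounded_linear_continuous (p * a)) => //; rewrite mulr_ge0.
have proj_cont k (i : 'I_k) : continuous (fun h : {ptws 'I_k -> B} => h i).
  move=> h; exact: (@proj_continuous _ (fun=> B) i h).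
have cont2 x : continuous (fun h : {ptws 'I_2 -> B} => f2 x (h i0) (h i1)).
  move=> h; have pa0 : 0 <= p ^+ 2 * a by rewrite mulr_ge0 ?exprn_ge0.
  exact: (@bilinear_cvg (p ^+ 2 * a) (f2 x) {ptws 'I_2 -> B} (nbhs h) _
    (fun h => h i0) (fun h => h i1) (h i0) (h i1) pa0 (l2l x) (l2r x) (b2 x)
    (proj_cont _ i0 h) (proj_cont _ i1 h)).
have multi k x : (k <= m)%N -> multilinear (D k x) /\ continuous (D k x).
  move=> km; have {km m2} : (k <= 2)%N by exact: leq_trans m2.
  case: k => [|[|[|//]]] _; split.
  - by move=> h [].
  - exact: (@cst_continuous {ptws 'I_0 -> B} R (f x)).
  - by move=> h i c u v; rewrite /D /subst_arg (ord1 i) eqxx l1.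
  - move=> h.
    exact: (@continuous_comp {ptws 'I_1 -> B} B R (fun h => h ord0) (f1 x) h
      (@proj_cont 1%N ord0 h) (cont1 x (h ord0))).
  - move=> h i c u v; rewrite /D /subst_arg.
    have [->|->] : i = i0 \/ i = i1.
      by case: i => -[|[|//]] ?; [left|right]; exact: val_inj.
    + by rewrite !eqxx [i1 == _]eq_sym [i0 == i1]/= l2l.
    + by rewrite !eqxx [i0 == i1]/= l2r.
  - exact: cont2.
have [Dc Dh] : form_continuous (D m) /\ forall x y,
    (form_norm (fun h => (D m x h - D m y h)%R) <= (`|x - y| `^ (s - m%:R))%:E)%E.
  apply: (@form_norm_hoelder m (D m) 1 (p ^+ m.+1 * a)) => //.
  - rewrite (le_trans _ pa)// -mulrA ler_peMl ?ler1n// mulr_ge0 ?exprn_ge0//.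
  (* The oscillation of [D m] is at most 1: from |f| <= 1/2 if m = 0, and otherwise from two values
     of size p^m a, which is where the 2 in the hypothesis comes from. *)
  - move=> x y h h1; case: m m2 pa {sm0 sm1 multi} h h1 => [|m] m2 pa h h1.
      rewrite (le_trans (ler_normB _ _))// (splitr 1) div1r lerD//; exact: fh.
    have pa' : 2 * p ^+ m.+1 * a <= 1.
      by rewrite (le_trans _ pa)// ler_wpM2r// ler_wpM2l// pX.
    case: m m2 {pa} pa' h h1 => [|[|//]] _ pa h h1.
      rewrite (le_trans (ler_normB _ _))// (le_trans _ pa)//.
      have E z : `|f1 z (h ord0)| <= p * a.
        by rewrite (le_trans (b1 _ _))// ler_piMr// mulr_ge0.
      have := E x; have := E y; rewrite /D; lra.
    rewrite (le_trans (ler_normB _ _))// (le_trans _ pa)//.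
    have E z : `|f2 z (h i0) (h i1)| <= p ^+ 2 * a.
      by rewrite (le_trans (b2 _ _ _))// ler_piMr ?h1M// mulr_ge0 ?exprn_ge0.
    have := E x; have := E y; rewrite /D; lra.
  - by move=> x y h h1; exact: lip.
exists D; split => //; split => // k x e km e0.
have k1 : (k < 2)%N by exact: leq_trans m2.
apply: (@form_norm_frechet k (D k) (fun x u h => D k.+1 x (cons_arg u h))
  (p ^+ k.+2 * a)) => //; first by rewrite mulr_ge0 ?exprn_ge0.
move=> u h h1; move: k k1 h h1 {km} => [|[|//]] _ h h1.
- change (`|f (x + u) - f x - f1 x (cons_arg u h ord0)| <= p ^+ 2 * a * `|u| ^+ 2).
  rewrite [cons_arg u h ord0](_ : _ = u); last by rewrite /cons_arg unlift_none.
  apply: (@mean_value_bound2 _ _ f (f1 ^~ u) (fun z => f2 z u u) x u _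
    (fun z => d1 z u) (fun z => d2 z u u)) => z.
  by rewrite (expr2 `|u|); exact: b2.
- change (`|f1 (x + u) (h ord0) - f1 x (h ord0)
      - f2 x (cons_arg u h i0) (cons_arg u h i1)| <= p ^+ 3 * a * `|u| ^+ 2).
  rewrite [cons_arg u h i0](_ : _ = u); last by rewrite /cons_arg unlift_none.
  rewrite [cons_arg u h i1](_ : _ = h ord0); last by rewrite /cons_arg liftK.
  apply: (@mean_value_bound2 _ _ (f1 ^~ (h ord0)) (fun z => f2 z u (h ord0))
    (fun z => f3 z u u (h ord0)) x u _ (fun z => d2 z u (h ord0))
    (fun z => d3 z u u (h ord0))) => z.
  rewrite (le_trans (b3 _ _ _ _))// ler_wpM2l ?mulr_ge0 ?exprn_ge0//.
  by rewrite (expr2 `|u|) ler_wpM2l// ler_piMr.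
Qed.

End jet_zolotarev.

(** * Smooth separation of unions of balls *)

Section soft_indicator.
Context {R : realType}.

Definition sigmoid (z : R) : R := (1 + expR (- z))^-1.

Lemma sigmoid_gt0 z : 0 < sigmoid z.
Proof. by rewrite invr_gt0 addr_gt0// expR_gt0. Qed.

Lemma sigmoid_le1 z : sigmoid z <= 1.
Proof. by rewrite invf_le1 ?addr_gt0 ?expR_gt0// lerDl expR_ge0. Qed.

Lemma sigmoidN z : sigmoid (- z) = 1 - sigmoid z.
Proof.
rewrite /sigmoid opprK expRN; have := expR_gt0 z; set e := expR z => e0.
by field; rewrite ?gt_eqF ?addr_gt0.
Qed.

Lemma sigmoid_le : {homo sigmoid : x y / x <= y}.
Proof.
move=> x y xy; rewrite lef_pV2 ?posrE ?addr_gt0 ?expR_gt0//.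
by rewrite lerD2l ler_expR lerN2.
Qed.

Lemma sigmoid_small (c e : R) : 0 < c -> 0 < e ->
  exists2 L, 1 <= L & sigmoid (- (L * c)) <= e.
Proof.
(* By exp y >= 1 + y it is enough that L c >= 1 / e; the summand 1 ensures 1 <= L. *)
move=> c0 e0; exists (1 + (e * c)^-1); first by rewrite lerDl invr_ge0 ltW ?mulr_gt0.
rewrite /sigmoid opprK invf_ple ?posrE ?addr_gt0 ?expR_gt0//.
apply: (@le_trans _ _ (1 + (1 + (e * c)^-1) * c)); last first.
  by rewrite lerD2l (le_trans _ (expR_ge1Dx _))// lerDr.
have -> : (1 + (e * c)^-1) * c = c + e^-1 by field; rewrite ?gt_eqF.
have := ltW c0; lra.
Qed.

#[local] Instance is_derive_sigmoid (z : R) :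
  is_derive z 1 sigmoid (sigmoid z * (1 - sigmoid z)).
Proof.
have e0 : 0 < expR (- z) by exact: expR_gt0.
have d : is_derive z 1 (fun z => 1 + expR (- z)) (- expR (- z)).
  have -> : (fun z : R => 1 + expR (- z)) = cst 1 + (expR \o -%R) by [].
  by apply: is_derive_eq; rewrite add0r mulrN1.
rewrite /sigmoid; apply: (is_derive_eq (is_deriveV _ d)).
  by rewrite gt_eqF// addr_gt0.
by rewrite /GRing.scale/=; field; rewrite gt_eqF// addr_gt0.
Qed.

Lemma is_derive_sigmoid2 (z : R) :
  is_derive z 1 (fun z => sigmoid z * (1 - sigmoid z))
    (sigmoid z * (1 - sigmoid z) * (1 - 2 * sigmoid z)).
Proof.
apply: (is_derive_eq (is_deriveM (is_derive_sigmoid z)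
  (is_deriveB (is_derive_cst (1 : R) z 1) (is_derive_sigmoid z)))).
by rewrite ?fctE /= /GRing.scale/=; ring.
Qed.

Lemma is_derive_sigmoid3 (z : R) :
  is_derive z 1 (fun z => sigmoid z * (1 - sigmoid z) * (1 - 2 * sigmoid z))
    (sigmoid z * (1 - sigmoid z) *
       ((1 - 2 * sigmoid z) ^+ 2 - 2 * (sigmoid z * (1 - sigmoid z)))).
Proof.
apply: (is_derive_eq (is_deriveM (is_derive_sigmoid2 z)
  (is_deriveB (is_derive_cst (1 : R) z 1) (is_deriveZ 2 (is_derive_sigmoid z))))).
by rewrite ?fctE /= /GRing.scale/=; ring.
Qed.

Lemma sigmoid_deriv_bounds (z : R) : let s := sigmoid z in
  [/\ `|s * (1 - s)| <= 1, `|s * (1 - s) * (1 - 2 * s)| <= 1 &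
      `|s * (1 - s) * ((1 - 2 * s) ^+ 2 - 2 * (s * (1 - s)))| <= 1].
Proof.
move=> s; have s0 : 0 <= s by exact/ltW/sigmoid_gt0.
have s1 : s <= 1 by exact: sigmoid_le1.
have b1 : `|s * (1 - s)| <= 1.
  by rewrite normrM mulr_ile1// ger0_norm//; lra.
split => //; rewrite normrM mulr_ile1// ler_norml; first by apply/andP; split; lra.
by apply/andP; split; nra.
Qed.

Context {B : normedModType R} {I J : finType}.
Variables (l : J -> B -> R) (b : I -> J -> R).

(* As p grows, ln (soft_minmax p x) / p tends to - min_i max_j (l j x - b i j),
   which is positive on a union over i of balls and negative far from it. *)
Definition soft_max p i (x : B) := \sum_j expR (p * (l j x - b i j)).
Definition soft_minmax p (x : B) := \sum_i (soft_max p i x)^-1.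
Definition soft_indicator (L p : R) (x : B) :=
  sigmoid (L / p * ln (soft_minmax p x)).

Lemma soft_max_ge p i j x : expR (p * (l j x - b i j)) <= soft_max p i x.
Proof.
rewrite /soft_max (bigD1 j)//= lerDl sumr_ge0// => k _; exact: expR_ge0.
Qed.

Lemma soft_max_gt0 (j : J) p i x : 0 < soft_max p i x.
Proof. exact: lt_le_trans (expR_gt0 _) (soft_max_ge p i j x). Qed.

Lemma soft_minmax_ge (j : J) p i x : (soft_max p i x)^-1 <= soft_minmax p x.
Proof.
rewrite /soft_minmax (bigD1 i)//= lerDl sumr_ge0// => k _.
by rewrite invr_ge0 ltW// (soft_max_gt0 j).
Qed.

Lemma soft_minmax_gt0 (i : I) (j : J) p x : 0 < soft_minmax p x.
Proof.
by apply: lt_le_trans (soft_minmax_ge j p i x); rewrite invr_gt0 (soft_max_gt0 j).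
Qed.

Lemma soft_max_has_jet p i : 0 <= p ->
  (forall j a u v, l j (a *: u + v) = a * l j u + l j v) ->
  (forall j u, `|l j u| <= `|u|) ->
  has_jet p (fun x => 5 * soft_max p i x) (soft_max p i).
Proof.
move=> p0 ll lb.
have -> : (fun x => 5 * soft_max p i x) =
    (fun x => \sum_j 5 * expR (p * (l j x - b i j))).
  by apply/funext => x; rewrite /soft_max mulr_sumr.
apply: has_jet_sum => j.
apply: (@has_jet_comp _ _ p (cst 1) (fun x => expR (p * (l j x - b i j)))
  (fun x => p * (l j x - b i j)) expR expR expR expR) => //.
- exact: has_jet_affine (ll j) (lb j).
- by move=> x; rewrite mulr1 ger0_norm ?expR_ge0.
- by move=> x; rewrite expr1n mulr1 ger0_norm ?expR_ge0.
- by move=> x; rewrite expr1n mulr1 ger0_norm ?expR_ge0.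
Qed.

Lemma is_derive_invX n (z : R) : 0 < z ->
  is_derive z 1 (fun z => z ^- n.+1) (- n.+1%:R * z ^- n.+2).
Proof.
move=> z0; have d : is_derive z 1 (fun z : R => z ^+ n.+1) (n.+1%:R * z ^+ n).
  have -> : (fun z : R => z ^+ n.+1) = id ^+ n.+1.
    by apply/funext => y; rewrite exprfctE.
  by apply: (is_derive_eq (is_deriveX n.+1 (is_derive_id z 1)));
    rewrite /GRing.scale/= mulr1.
apply: (is_derive_eq (is_deriveV _ d)); first by rewrite gt_eqF// exprn_gt0.
have zn : z ^+ n != 0 by rewrite gt_eqF// exprn_gt0.
by rewrite /GRing.scale/= !exprS; field; rewrite zn gt_eqF.
Qed.

(** With the weight 5 Z of [soft_max], the conditions of [has_jet_comp] for 1 / z ask for 5 / Z, 50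
    / Z and 750 / Z; 10^3 / Z is a round common bound. *)
Lemma soft_max_inv_has_jet (j0 : J) p i : 0 <= p ->
  (forall j a u v, l j (a *: u + v) = a * l j u + l j v) ->
  (forall j u, `|l j u| <= `|u|) ->
  has_jet p (fun x => 5 * (10 ^+ 3 * (soft_max p i x)^-1))
    (fun x => (soft_max p i x)^-1).
Proof.
move=> p0 ll lb; have Z0 := soft_max_gt0 j0 p i.
apply: (@has_jet_comp _ _ p (fun x => 5 * soft_max p i x)
  (fun x => 10 ^+ 3 * (soft_max p i x)^-1)
  (soft_max p i) (fun z => z ^- 1) (fun z => - 1 * z ^- 2)
  (fun z => 2 * z ^- 3) (fun z => - 6 * z ^- 4)) => //.
- by move=> x; rewrite mulr_ge0// ltW.
- exact: soft_max_has_jet.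
- by move=> x; exact: is_derive_invX.
- move=> x; apply: (is_derive_eq (is_deriveZ (- 1) (is_derive_invX 1 (Z0 x)))).
  by rewrite /GRing.scale/=; ring.
- move=> x; apply: (is_derive_eq (is_deriveZ 2 (is_derive_invX 2 (Z0 x)))).
  by rewrite /GRing.scale/=; ring.
- move=> x; have z0 := Z0 x; rewrite mulN1r normrN ger0_norm; last first.
    by rewrite invr_ge0 exprn_ge0// ltW.
  rewrite [leLHS](_ : _ = 5 * (soft_max p i x)^-1); last by field; rewrite gt_eqF.
  by rewrite ler_wpM2r ?invr_ge0 ?(ltW z0)//; lra.
- move=> x; have z0 := Z0 x; rewrite ger0_norm; last first.
    by rewrite mulr_ge0// invr_ge0 exprn_ge0// ltW.
  rewrite [leLHS](_ : _ = 50 * (soft_max p i x)^-1); last by field; rewrite gt_eqF.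
  by rewrite ler_wpM2r ?invr_ge0 ?(ltW z0)//; lra.
- move=> x; have z0 := Z0 x; rewrite mulNr normrN ger0_norm; last first.
    by rewrite mulr_ge0// invr_ge0 exprn_ge0// ltW.
  rewrite [leLHS](_ : _ = 6 * 5 ^+ 3 * (soft_max p i x)^-1); last first.
    by field; rewrite gt_eqF.
  by rewrite ler_wpM2r ?invr_ge0 ?(ltW z0)//; lra.
Qed.

(** [c] is the ratio of weight to value for [soft_minmax], and [d] is the weight left after its
    logarithm: for ln the conditions of [has_jet_comp] read c, c^2 and 2 c^3. *)
Let c : R := 5 * 10 ^+ 3.
Let d : R := 5 * (2 * c ^+ 3).

Lemma ln_soft_minmax_has_jet (i0 : I) (j0 : J) p : 0 <= p ->
  (forall j a u v, l j (a *: u + v) = a * l j u + l j v) ->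
  (forall j u, `|l j u| <= `|u|) ->
  has_jet p (cst d) (fun x => ln (soft_minmax p x)).
Proof.
move=> p0 ll lb; have W0 := soft_minmax_gt0 i0 j0 p.
have c1 : 1 <= c by rewrite /c; lra.
change (has_jet p (fun x => 5 * cst (2 * c ^+ 3) x) (@ln R \o soft_minmax p)).
apply: (@has_jet_comp _ _ p (fun x => c * soft_minmax p x) (cst (2 * c ^+ 3))
  (soft_minmax p) (@ln R) (fun z => z ^- 1) (fun z => - 1 * z ^- 2)
  (fun z => 2 * z ^- 3)) => //.
- by move=> x; rewrite mulr_ge0 ?(ltW (W0 x))// (le_trans _ c1).
- rewrite (_ : (fun x => c * _) =
    (fun x => \sum_i 5 * (10 ^+ 3 * (soft_max p i x)^-1))).
    by apply: has_jet_sum => i; exact: soft_max_inv_has_jet.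
  by apply/funext => x; rewrite /soft_minmax mulr_sumr; apply: eq_bigr => i _; rewrite mulrA.
- by move=> x; exact: is_derive1_ln.
- by move=> x; exact: is_derive_invX.
- move=> x; apply: (is_derive_eq (is_deriveZ (- 1) (is_derive_invX 1 (W0 x)))).
  by rewrite /GRing.scale/=; ring.
- move=> x; have z0 := W0 x; rewrite ger0_norm; last first.
    by rewrite invr_ge0 exprn_ge0// ltW.
  rewrite [leLHS](_ : _ = c); last by field; rewrite gt_eqF.
  rewrite (@le_trans _ _ (c ^+ 3))//; first by rewrite -{1}(expr1 c) ler_weXn2l.
  by rewrite ler_peMl ?ler1n// exprn_ge0// (le_trans _ c1).
- move=> x; have z0 := W0 x; rewrite mulN1r normrN ger0_norm; last first.
    by rewrite invr_ge0 exprn_ge0// ltW.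
  rewrite [leLHS](_ : _ = c ^+ 2); last by field; rewrite gt_eqF.
  rewrite (@le_trans _ _ (c ^+ 3))//; first by rewrite ler_weXn2l.
  by rewrite ler_peMl ?ler1n// exprn_ge0// (le_trans _ c1).
- move=> x; have z0 := W0 x; rewrite ger0_norm; last first.
    by rewrite mulr_ge0// invr_ge0 exprn_ge0// ltW.
  by rewrite [leLHS](_ : _ = 2 * c ^+ 3)//; field; rewrite gt_eqF.
Qed.

(** The n-th derivative of z |-> sigmoid (k z) brings k^n with k = L / p, and (k d)^n = (L d / p)^n
    <= (L d)^3 / p for n = 1, 2, 3, because L d and p are at least 1. *)
Lemma soft_indicator_has_jet (i0 : I) (j0 : J) L p : 1 <= L -> 1 <= p ->
  (forall j a u v, l j (a *: u + v) = a * l j u + l j v) ->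
  (forall j u, `|l j u| <= `|u|) ->
  has_jet p (cst (5 * ((L * d) ^+ 3 / p))) (soft_indicator L p).
Proof.
move=> L1 p1 ll lb; have p0 : 0 < p by exact: lt_le_trans p1.
have d1 : 1 <= d by rewrite /d /c; lra.
have M1 : 1 <= L * d by rewrite mulr_ege1.
pose k := L / p; have k0 : 0 <= k by rewrite divr_ge0 ?(ltW p0)// (le_trans _ L1).
have Mk : k * d = L * d / p by rewrite /k; field; rewrite gt_eqF.
have ders (n : nat) (g g' : R -> R) (dg : forall z : R, is_derive z 1 g (g' z))
      (z : R) :
    is_derive z 1 (fun z : R => k ^+ n * g (k * z)) (k ^+ n.+1 * g' (k * z)).
  have dk : is_derive z 1 (fun z : R => k * z) k.
    by apply: is_derive_eq; rewrite /GRing.scale/= mulr1.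
  apply: (is_derive_eq (is_deriveZ (k ^+ n) (is_derive1_comp (dg (k * z)) dk))).
  by rewrite /GRing.scale/= exprS; ring.
have bnd (n : nat) y : (0 < n <= 3)%N -> `|y| <= 1 ->
    `|k ^+ n * y| * d ^+ n <= (L * d) ^+ 3 / p.
  move=> /andP[n0 n3] y1; rewrite normrM (ger0_norm (exprn_ge0 _ k0)).
  apply: (@le_trans _ _ (k ^+ n * 1 * d ^+ n)).
    by rewrite ler_wpM2r ?exprn_ge0 ?(le_trans _ d1)// ler_wpM2l ?exprn_ge0.
  rewrite mulr1 -exprMn Mk exprMn ler_pM ?exprn_ge0 ?invr_ge0 ?(ltW p0)//.
  - by rewrite (le_trans _ M1).
  - by rewrite ler_weXn2l.
  - by rewrite -[leRHS]expr1 ler_wiXn2l// ?invr_ge0 ?(ltW p0)// invf_le1.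
change (has_jet p (fun x => 5 * cst ((L * d) ^+ 3 / p) x)
  ((fun z => sigmoid (k * z)) \o (fun x => ln (soft_minmax p x)))).
apply: (@has_jet_comp _ _ p (cst d) (cst ((L * d) ^+ 3 / p))
  (fun x => ln (soft_minmax p x)) (fun z => sigmoid (k * z))
  (fun z => k ^+ 1 * (sigmoid (k * z) * (1 - sigmoid (k * z))))
  (fun z => k ^+ 2 * (sigmoid (k * z) * (1 - sigmoid (k * z))
                       * (1 - 2 * sigmoid (k * z))))
  (fun z => k ^+ 3 * (sigmoid (k * z) * (1 - sigmoid (k * z)) *
     ((1 - 2 * sigmoid (k * z)) ^+ 2
       - 2 * (sigmoid (k * z) * (1 - sigmoid (k * z))))))) => /=.
- exact: ltW.
- by move=> _; rewrite (le_trans _ d1).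
- by apply: ln_soft_minmax_has_jet => //; exact: ltW.
- move=> x; have := ders 0 _ _ is_derive_sigmoid (ln (soft_minmax p x)).
  by rewrite (_ : (fun z => k ^+ 0 * _) = fun z => sigmoid (k * z))//;
    apply/funext => z; rewrite expr0 mul1r.
- by move=> x; exact: (ders 1 _ _ is_derive_sigmoid2).
- by move=> x; exact: (ders 2 _ _ is_derive_sigmoid3).
- by move=> x; rewrite -{2}(expr1 d) bnd//; case: (sigmoid_deriv_bounds (k * ln (soft_minmax p x))).
- by move=> x; rewrite bnd//; case: (sigmoid_deriv_bounds (k * ln (soft_minmax p x))).
- by move=> x; rewrite bnd//; case: (sigmoid_deriv_bounds (k * ln (soft_minmax p x))).
Qed.

End soft_indicator.

(** C is fixed before the space, the balls, the grid and p, so one constant serves all n. *)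
Lemma soft_indicator_zol_class {R : realType} (L : R) : 1 <= L ->
  exists2 C : R, 1 <= C & forall (B : normedModType R) (I J : finType)
    (l : J -> B -> R) (b : I -> J -> R) (i0 : I) (j0 : J) (p s : R),
  (zol_order s <= 2)%N -> 0 < s - (zol_order s)%:R ->
  s - (zol_order s)%:R <= 1 -> 1 <= p ->
  (forall j a u v, l j (a *: u + v) = a * l j u + l j v) ->
  (forall j u, `|l j u| <= `|u|) ->
  zol_class s (fun x => (2 * C * p ^+ zol_order s)^-1 * soft_indicator l b L p x).
Proof.
(* The weight of [ln_soft_minmax_has_jet] in closed form. *)
move=> L1; pose d : R := 5 * (2 * (5 * 10 ^+ 3) ^+ 3).
have d1 : 1 <= d by rewrite /d; lra.
pose C := 5 * (L * d) ^+ 3.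
have C1 : 1 <= C by rewrite /C mulr_ege1 ?ler1n// exprn_ege1// mulr_ege1.
exists C => // B I J l b i0 j0 p s m2 sm0 sm1 p1 ll lb.
have p0 : 0 < p by exact: lt_le_trans p1.
have Q0 : 0 < (L * d) ^+ 3 by move: C1; rewrite /C; lra.
have := soft_indicator_has_jet b i0 j0 L1 p1 ll lb.
move=> /(has_jetZ (2 * C * p ^+ zol_order s)^-1)[f1 [f2 [f3 fj]]].
have K1 : 1 <= C * p ^+ zol_order s by rewrite mulr_ege1// exprn_ege1.
have K0 : 0 < C * p ^+ zol_order s by exact: lt_le_trans K1.
apply: (@jet_zol_class _ _ s p
  (`|(2 * C * p ^+ zol_order s)^-1| * (5 * ((L * d) ^+ 3 / p))) _ f1 f2 f3
  m2 sm0 sm1 p1 _ _ _ fj) => /=.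
- by rewrite mulr_ge0// mulr_ge0// divr_ge0// ltW.
- have N0 : 0 < (2 * C * p ^+ zol_order s)^-1 by rewrite invr_gt0 -mulrA mulr_gt0.
  (* C is chosen so that the hypothesis of [jet_zol_class] on p and a holds with equality. *)
  rewrite (gtr0_norm N0) [leLHS](_ : _ = 1)// exprS /C.
  move: Q0; set Q := (L * d) ^+ 3 => Q0.
  have P0 : 0 < p ^+ zol_order s by rewrite exprn_gt0.
  move: P0; set X := p ^+ _ => X0; field.
  by rewrite ?(gt_eqF p0) ?(gt_eqF Q0) ?(gt_eqF X0).
- move=> x; have si0 := sigmoid_gt0 (L / p * ln (soft_minmax l b p x)).
  have si1 := sigmoid_le1 (L / p * ln (soft_minmax l b p x)).
  rewrite ger0_norm; last by rewrite mulr_ge0 ?(ltW si0)// invr_ge0 -mulrA mulr_ge0// ltW.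
  rewrite -mulrA invfM -mulrA ler_piMr//.
  apply: mulr_ile1 => //; first by rewrite invr_ge0 ltW.
  - exact: ltW.
  - by rewrite invf_le1.
Qed.

Section soft_indicator_bounds.
Context {R : realType} {B : normedModType R} {I J : finType}.
Variables (l : J -> B -> R) (b : I -> J -> R).

Lemma sumr_le_cst (K : finType) (f : K -> R) (c : R) :
  (forall k, f k <= c) -> \sum_k f k <= #|K|%:R * c.
Proof.
move=> fc; rewrite mulr_natl -[leRHS]sumr_const.
exact: ler_sum.
Qed.

(** Half of the margin 2 g absorbs the number of terms: the soft maximum is at most #|J| exp (- 2 p
    g) <= exp (- p g). *)
Lemma soft_indicator_ge (L p g : R) (j0 : J) i x : 0 < p -> 0 <= L ->
  #|J|%:R <= expR (p * g) -> (forall j, l j x - b i j <= - (2 * g)) ->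
  sigmoid (L * g) <= soft_indicator l b L p x.
Proof.
move=> p0 L0 Jg lb; apply: sigmoid_le.
have Z : soft_max l b p i x <= expR (- (p * g)).
  apply: (@le_trans _ _ (#|J|%:R * expR (- (2 * (p * g))))).
    apply: sumr_le_cst => j; rewrite ler_expR.
    by rewrite [leRHS](_ : _ = p * (- (2 * g))) ?ler_pM2l//; ring.
  apply: (@le_trans _ _ (expR (p * g) * expR (- (2 * (p * g))))).
    by rewrite ler_wpM2r// expR_ge0.
  by rewrite -expRD ler_expR; lra.
have W : expR (p * g) <= soft_minmax l b p x.
  apply: le_trans (soft_minmax_ge l b j0 p i x).
  by rewrite -[p * g]opprK expRN lef_pV2// posrE ?expR_gt0// (soft_max_gt0 l b j0).
have W0 : 0 < soft_minmax l b p x by exact: soft_minmax_gt0.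
apply: (@le_trans _ _ (L / p * (p * g))).
  by rewrite [leLHS](_ : _ = L / p * (p * g))//; field; rewrite gt_eqF.
rewrite ler_wpM2l// ?divr_ge0 ?(ltW p0)//.
by rewrite -[leLHS]expRK ler_ln// posrE expR_gt0.
Qed.

(** Dually, each inverse soft maximum is at most exp (- 2 p g), and half of the margin absorbs the
    #|I| of them. *)
Lemma soft_indicator_le (L p g : R) (i0 : I) (j0 : J) x : 0 < p -> 0 <= L ->
  #|I|%:R <= expR (p * g) -> (forall i, exists j, 2 * g <= l j x - b i j) ->
  soft_indicator l b L p x <= sigmoid (- (L * g)).
Proof.
move=> p0 L0 Ig lb; apply: sigmoid_le.
have W0 : 0 < soft_minmax l b p x by exact: soft_minmax_gt0.
have W : soft_minmax l b p x <= expR (- (p * g)).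
  apply: (@le_trans _ _ (#|I|%:R * expR (- (2 * (p * g))))).
    apply: sumr_le_cst => i; have [j lj] := lb i.
    rewrite expRN lef_pV2 ?posrE ?expR_gt0 ?(soft_max_gt0 l b j0)//.
    apply: le_trans (soft_max_ge l b p i j x); rewrite ler_expR.
    by rewrite [leLHS](_ : _ = p * (2 * g)) ?ler_pM2l//; ring.
  apply: (@le_trans _ _ (expR (p * g) * expR (- (2 * (p * g))))).
    by rewrite ler_wpM2r// expR_ge0.
  by rewrite -expRD ler_expR; lra.
apply: (@le_trans _ _ (L / p * (- (p * g)))).
  rewrite ler_wpM2l// ?divr_ge0 ?(ltW p0)//.
  by rewrite -[leRHS]expRK ler_ln// posrE expR_gt0.
by rewrite [leLHS](_ : _ = - (L * g))//; field; rewrite gt_eqF.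
Qed.

Lemma sigmoid_measurable : measurable_fun setT (@sigmoid R).
Proof. by apply: nondecreasing_measurable => //; exact: sigmoid_le. Qed.

Lemma measurable_inv_gt0 d (S : measurableType d) (f : S -> R) :
  (forall x, 0 < f x) -> measurable_fun setT f ->
  measurable_fun setT (fun x => (f x)^-1).
Proof.
move=> f0 mf; rewrite (_ : (fun x => _) = (fun x => expR (- ln (f x)))).
  apply: measurableT_comp; first exact: measurable_expR.
  by apply: measurableT_comp => //; apply: measurableT_comp; first exact: measurable_ln.
by apply/funext => x; rewrite expRN lnK ?posrE.
Qed.

Lemma soft_indicator_measurable (j0 : J) d (S : measurableType d) (g : S -> B) L p :
  (forall j, measurable_fun setT (fun x => l j (g x))) ->
  measurable_fun setT (fun x => soft_indicator l b L p (g x)).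
Proof.
move=> lg; apply: measurableT_comp; first exact: sigmoid_measurable.
apply: measurable_funM => //; apply: measurableT_comp; first exact: measurable_ln.
apply: measurable_sum => i; apply: measurable_inv_gt0 => [x|].
  exact: soft_max_gt0.
apply: measurable_sum => j; apply: measurableT_comp; first exact: measurable_expR.
by apply: measurable_funM => //; exact: measurable_funB.
Qed.

End soft_indicator_bounds.

(** * Expectations of bounded random variables *)

Section bounded_expectation.
Context {d} {T : measurableType d} {R : realType} (P : probability T R).
Implicit Types f g : T -> R.

Definition bounded_measurable f :=
  measurable_fun setT f /\ exists M, forall w, `|f w| <= M.

Lemma bounded_measurable_cst c : bounded_measurable (cst c).
Proof. by split => //; exists `|c|. Qed.

Lemma bounded_measurableD f g : bounded_measurable f -> bounded_measurable g ->
  bounded_measurable (f \+ g).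
Proof.
move=> [mf [M fM]] [mg [N gN]]; split; first exact: measurable_funD.
by exists (M + N) => w /=; rewrite (le_trans (ler_normD _ _))// lerD.
Qed.

Lemma bounded_measurableZ c f : bounded_measurable f ->
  bounded_measurable (fun w => c * f w).
Proof.
move=> [mf [M fM]]; split; first exact: measurable_funM.
by exists (`|c| * M) => w; rewrite normrM ler_wpM2l.
Qed.

Lemma bounded_measurableB f g : bounded_measurable f -> bounded_measurable g ->
  bounded_measurable (f \- g).
Proof.
move=> [mf [M fM]] [mg [N gN]]; split; first exact: measurable_funB.
by exists (M + N) => w /=; rewrite (le_trans (ler_normB _ _))// lerD.
Qed.

Lemma bounded_measurable_indic (A : set T) : measurable A ->
  bounded_measurable (\1_A).
Proof.
move=> mA; split; first exact: measurable_indic.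
by exists 1 => w; rewrite indicE; case: (_ \in _); rewrite ?normr1 ?normr0.
Qed.

Lemma bounded_measurable_sum (I : Type) (s : seq I) (f : I -> T -> R) :
  (forall i, bounded_measurable (f i)) ->
  bounded_measurable (fun w => \sum_(i <- s) f i w).
Proof.
move=> bf; elim: s => [|i s IH].
  rewrite (_ : (fun w => _) = cst 0); first exact: bounded_measurable_cst.
  by apply/funext => w; rewrite big_nil.
rewrite (_ : (fun w => _) = f i \+ (fun w => \sum_(i <- s) f i w)).
  exact: bounded_measurableD.
by apply/funext => w; rewrite big_cons.
Qed.

Lemma bounded_measurable_Lfun f : bounded_measurable f -> f \in Lfun P 1.
Proof.
move=> [mf [M fM]]; apply/Lfun1_integrable.
apply: (@le_integrable _ _ _ P setT measurableT (EFin \o f) (EFin \o cst M)).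
- exact/measurable_EFinP.
- move=> w _ /=; rewrite lee_fin (le_trans (fM w))//; exact: ler_norm.
- exact: finite_measure_integrable_cst.
Qed.

(** As real numbers, expectations can enter linear arithmetic. *)
Definition rexp f : R := fine ('E_P[f])%E.

Lemma rexpE f : bounded_measurable f -> ('E_P[f] = (rexp f)%:E)%E.
Proof.
move=> bf; rewrite /rexp fineK// expectation_fin_num//.
exact: bounded_measurable_Lfun.
Qed.

Lemma rexp_cst c : rexp (cst c) = c.
Proof. by rewrite /rexp expectation_cst. Qed.

Lemma rexp_indic (A : set T) : measurable A -> P A = (rexp \1_A)%:E.
Proof.
by move=> mA; rewrite -rexpE ?expectation_indic//; exact: bounded_measurable_indic.
Qed.

Lemma rexpD f g : bounded_measurable f -> bounded_measurable g ->
  rexp (f \+ g) = rexp f + rexp g.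
Proof.
move=> bf bg; apply: EFin_inj; rewrite EFinD -!rexpE//.
  by rewrite expectationD//; exact: bounded_measurable_Lfun.
exact: bounded_measurableD.
Qed.

Lemma rexpB f g : bounded_measurable f -> bounded_measurable g ->
  rexp (f \- g) = rexp f - rexp g.
Proof.
move=> bf bg; apply: EFin_inj; rewrite EFinB -!rexpE//.
  by rewrite expectationB//; exact: bounded_measurable_Lfun.
exact: bounded_measurableB.
Qed.

Lemma rexpZ c f : bounded_measurable f -> rexp (fun w => c * f w) = c * rexp f.
Proof.
move=> bf; apply: EFin_inj; rewrite EFinM -!rexpE//.
  rewrite -expectationZl//; last exact: bounded_measurable_Lfun.
  by congr ('E_P[_])%E; apply/funext => w /=; rewrite mulrC.
exact: bounded_measurableZ.
Qed.

Lemma rexp_sum (I : Type) (s : seq I) (f : I -> T -> R) :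
  (forall i, bounded_measurable (f i)) ->
  rexp (fun w => \sum_(i <- s) f i w) = \sum_(i <- s) rexp (f i).
Proof.
move=> bf; elim: s => [|i s IH].
  rewrite (_ : (fun w => _) = cst 0) ?rexp_cst ?big_nil//.
  by apply/funext => w; rewrite big_nil.
rewrite (_ : (fun w => _) = f i \+ (fun w => \sum_(i <- s) f i w)).
  by rewrite rexpD ?IH ?big_cons//; exact: bounded_measurable_sum.
by apply/funext => w; rewrite big_cons.
Qed.

Lemma rexp_le f g : bounded_measurable f -> bounded_measurable g ->
  (forall w, f w <= g w) -> rexp f <= rexp g.
Proof.
move=> bf bg fg; rewrite -subr_ge0 -rexpB// -lee_fin -rexpE.
  by apply: expectation_ge0 => w; rewrite subr_ge0.
exact: bounded_measurableB.
Qed.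

End bounded_expectation.

(** * Separability of C[0, 1] *)

Lemma finite_lower_bound (R : realType) (Q : nat -> R -> Prop) q :
  (forall i, exists2 c, 0 < c & Q i c) ->
  (forall i c c', 0 < c' -> c' <= c -> Q i c -> Q i c') ->
  exists2 c, 0 < c & forall i, (i <= q)%N -> Q i c.
Proof.
move=> Qex Qmon; elim: q => [|q [c c0 Qc]].
  by have [c c0 Qc] := Qex 0%N; exists c => // i; rewrite leqn0 => /eqP ->.
have [c' c'0 Qc'] := Qex q.+1.
exists (Num.min c c'); first by rewrite lt_min c0.
have m0 : 0 < Num.min c c' by rewrite lt_min c0.
move=> i; rewrite leq_eqVlt ltnS => /predU1P[->|iq].
  by apply: (Qmon _ c') => //; rewrite ge_min lexx orbT.
by apply: (Qmon _ c) (Qc i iq) => //; rewrite ge_min lexx.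
Qed.

Definition grid {R : realType} (N j : nat) : R := j%:R / N.+1%:R.

Lemma grid01 (R : realType) N j : (j <= N.+1)%N -> (grid N j : R) \in `[0, 1].
Proof.
by move=> jN; rewrite in_itv/= divr_ge0//= ler_pdivrMr// mul1r ler_nat.
Qed.

(** The first grid point after a is at most one grid step away, and [a + c <= 1] keeps its index
    within range. *)
Lemma grid_hits (R : realType) (N : nat) (a c : R) : 0 <= a -> a + c <= 1 ->
  N.+1%:R^-1 <= c -> exists2 j, (j <= N.+1)%N & grid N j \in `[a, a + c].
Proof.
move=> a0 ac1 Nc; have N0 : 0 < N.+1%:R :> R by [].
have aN0 : 0 <= a * N.+1%:R by rewrite mulr_ge0.
have /andP[t1 t2] := truncn_itv aN0; set j := Num.truncn _ in t1 t2.
have jin : grid N j.+1 \in `[a, a + c].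
  rewrite in_itv/=; apply/andP; split; first by rewrite ler_pdivlMr// ltW.
  apply: le_trans (_ : a + N.+1%:R^-1 <= _); last by rewrite lerD2l.
  rewrite ler_pdivrMr// mulrDl mulVf ?gt_eqF// -natr1 lerD2r//.
exists j.+1 => //; move: jin; rewrite in_itv/= => /andP[_ /le_trans/(_ ac1)].
by rewrite ler_pdivrMr// mul1r ler_nat.
Qed.

Section separability.
Context {R : realType}.
Implicit Type f : R -> R.

(** Around t, a point within rho / 2 and a step below rho / 2 stay within rho of t; compactness
    makes the step uniform. *)
Lemma within_unif_continuous f : {within `[0, 1], continuous f} ->
  forall e, 0 < e -> exists2 h, 0 < h & forall t u, t \in `[0, 1] ->
    u \in `[0, 1] -> `|t - u| < h -> `|f t - f u| < e.
Proof.
move=> /subspace_continuousP cf e e0.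
have /compact_near_coveringP K : compact (`[0, 1]%classic : set R).
  exact: segment_compact.
have [t t01|h [/= h0 hK]] := K _ (0^'+)
    (fun h t => t \in `[0, 1] -> forall u, u \in `[0, 1] -> `|t - u| < h ->
      `|f t - f u| < e) _.
  have e20 : 0 < e / 2 by rewrite divr_gt0.
  have := cf t t01; move=> /cvgrPdist_lt/(_ _ e20).
  rewrite near_withinE => -[rho /= rho0 ft].
  have rho20 : 0 < rho / 2 by rewrite divr_gt0.
  exists (ball t (rho / 2), [set h | h < rho / 2]).
    split; first exact: nbhsx_ballx.
    exact: nbhs_right_lt.
  move=> [t' h]/= [tt' hr] t'01 u u01 t'u.
  have ft' : `|f t - f t'| < e / 2.
    by apply: ft => //=; rewrite (lt_le_trans tt')// ler_piMr ?(ltW rho0)// invf_le1 ?ler1n.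
  have fu : `|f t - f u| < e / 2.
    apply: ft => //=; rewrite (le_lt_trans (ler_distD t' _ _))//.
    by rewrite (splitr rho) ltrD// (lt_trans t'u).
  by rewrite (le_lt_trans (ler_distD (f t) _ _))// (splitr e) ltrD// distrC.
(* The covering property holds for the positive radii strictly below h. *)
exists (h / 2); first by rewrite divr_gt0.
move=> t u t01 u01 tu; apply: (hK (h / 2)) => //=; last by rewrite divr_gt0.
by rewrite sub0r normrN gtr0_norm ?divr_gt0// ltr_pdivrMr// ltr_pMr// ltr1n.
Qed.

Lemma grid_cell N t : t \in `[0, 1] ->
  exists2 j, (j <= N)%N & t \in `[grid N j, grid N j.+1 : R].
Proof.
rewrite in_itv/= => /andP[t0]; rewrite le_eqVlt => /predU1P[->|t1].
  by exists N => //; rewrite in_itv/= /grid divff ?lexx ?andbT ?ler_pdivrMr ?mul1r ?ler_nat.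
have tN : 0 <= t * N.+1%:R by rewrite mulr_ge0.
have /andP[j1 j2] := truncn_itv tN.
exists (Num.truncn (t * N.+1%:R)).
  have : (Num.truncn (t * N.+1%:R))%:R < N.+1%:R :> R.
    by rewrite (le_lt_trans j1)// gtr_pMl.
  by rewrite ltr_nat ltnS.
by rewrite in_itv/= ler_pdivrMr// j1 ler_pdivlMr// ltW.
Qed.

(* The cells of codes (k, N, v) cover the continuous functions by sets of
   diameter at most 4 / (k + 1); there are countably many codes. *)
Definition code : Type := (nat * nat * seq int)%type.

Definition code_width (c : code) : R := c.1.1.+1%:R^-1.

Definition cell (c : code) : set (R -> R) := [set f : R -> R |
  {within `[0, 1], continuous f} /\
  forall j t, (j <= c.1.2)%N -> t \in `[grid c.1.2 j, grid c.1.2 j.+1] ->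
    `|f t - (nth 0 c.2 j)%:~R * code_width c| <= 2 * code_width c].

Lemma code_width_gt0 c : 0 < code_width c.
Proof. by rewrite invr_gt0. Qed.

Lemma cell_diam c f f' t : cell c f -> cell c f' -> t \in `[0, 1] ->
  `|f t - f' t| <= 4 * code_width c.
Proof.
move=> [_ cf] [_ cf'] t01; have [j jN tj] := grid_cell c.1.2 t01.
rewrite (le_trans (ler_distD ((nth 0 c.2 j)%:~R * code_width c) _ _))//.
have := cf _ _ jN tj; have := cf' _ _ jN tj; rewrite (distrC (f' t)); lra.
Qed.

(** One code width is lost by rounding f at the grid points down to multiples of 1 / (k + 1), the
    other by uniform continuity between grid points; this is the 2 in [cell]. *)
Lemma cell_cover f k : {within `[0, 1], continuous f} ->
  exists2 c : code, c.1.1 = k & cell c f.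
Proof.
move=> cf; have k0 : 0 < k.+1%:R^-1 :> R by rewrite invr_gt0.
have [h h0 fh] := within_unif_continuous cf k0.
pose N := Num.truncn h^-1.
have Nh : N.+1%:R^-1 < h.
  rewrite -[ltRHS]invrK ltf_pV2 ?posrE ?invr_gt0//.
  have hi0 : 0 <= h^-1 by rewrite invr_ge0 ltW.
  by have /andP[] := truncn_itv hi0.
pose v := [seq Num.floor (f (grid N j) * k.+1%:R) | j <- iota 0 N.+1].
exists ((k, N), v) => //; split => //= j t jN tj.
have gj01 : (grid N j : R) \in `[0, 1] by apply: grid01; exact: leqW.
have gj101 : (grid N j.+1 : R) \in `[0, 1] by apply: grid01.
have t01 : t \in `[0, 1].
  move: tj gj01 gj101; rewrite !in_itv/= => /andP[t1 t2] /andP[g1 _] /andP[_ g2].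
  by rewrite (le_trans g1 t1) (le_trans t2 g2).
have tg : `|t - grid N j| < h.
  move: tj; rewrite in_itv/= => /andP[t1 t2]; rewrite ger0_norm ?subr_ge0//.
  apply: le_lt_trans Nh; rewrite lerBlDl (le_trans t2)//.
  by rewrite /grid -natr1 mulrDl mul1r.
have ft := ltW (fh _ _ t01 gj01 tg).
rewrite (nth_map 0%N) ?size_iota ?nth_iota//= /code_width/=.
rewrite (le_trans (ler_distD (f (grid N j)) _ _))//.
rewrite [leRHS](_ : _ = k.+1%:R^-1 + k.+1%:R^-1); last by ring.
rewrite lerD//; have /andP[] := floor_itv (f (grid N j) * k.+1%:R).
set fl := Num.floor _; rewrite intrD => f1 f2.
rewrite -[X in `|X - _|](mulfK (_ : k.+1%:R != 0))// -mulrBl normrM.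
rewrite (gtr0_norm k0) ler_piMl ?(ltW k0)// ger0_norm ?subr_ge0//.
by rewrite lerBlDl ltW.
Qed.

(** The default for an empty cell keeps every center continuous. *)
Definition center (c : code) : R -> R := xget (cst 0) (cell c).

Lemma center_cell c f : cell c f -> cell c (center c).
Proof. by move=> cf; apply: xgetPex; exists f. Qed.

Lemma center_continuous c : {within `[0, 1], continuous (center c : R -> R)}.
Proof.
have [[f cf]|nf] := pselect (exists f, cell c f).
  by have [] := center_cell cf.
rewrite /center; case: xgetP => [f _ [] //|_].
by apply: continuous_subspaceT => x; exact: cvg_cst.
Qed.

End separability.

(** * Convergence of probabilities and expectations *)

Section zolotarev_convergence.
Context {d} {T : measurableType d} {R : realType} (P : probability T R).
Context {B : normedModType R} (ev : B -> R -> R).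
Context (s : R) (r : nat -> R) (z : nat -> \bar R).
Context (X_ : nat -> T -> B) (X : T -> B).

(* For B = D01 R the test functions have to be measurable on Dsk R, a type with
   another topology; hence the quantification over the maps g into B. *)
Definition ev_measurable (f : B -> R) := forall d' (S : measurableType d')
  (g : S -> B), (forall t, t \in `[0, 1] -> measurable_fun setT (fun x => ev (g x) t)) ->
  measurable_fun setT (fun x => f (g x)).

(** The constant c depends on x, b and g but not on n, w or t, so that a single grid tests all paths
    of X_n. *)
Definition long_excursions := forall x : R -> R, {within `[0, 1], continuous x} ->
  forall b g, 0 < g -> exists2 c, 0 < c & forall n w t,
    t \in `[0, 1] -> b < `|ev (X_ n w) t - x t| ->
    exists a, [/\ 0 <= a, a + c * r n <= 1 &
      forall u, u \in `[a, a + c * r n] -> b - g <= `|ev (X_ n w) u - x u|].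

Hypothesis m2 : (zol_order s <= 2)%N.
Hypothesis sm0 : 0 < s - (zol_order s)%:R.
Hypothesis sm1 : s - (zol_order s)%:R <= 1.
Hypothesis ev_lin : forall t a u v, ev (a *: u + v) t = a * ev u t + ev v t.
Hypothesis ev_bound : forall t u, t \in `[0, 1] -> `|ev u t| <= `|u|.
Hypothesis r01 : forall n, 0 < r n <= 1.
Hypothesis mX_ : forall n t, t \in `[0, 1] -> measurable_fun setT (fun w => ev (X_ n w) t).
Hypothesis mX : forall t, t \in `[0, 1] -> measurable_fun setT (fun w => ev (X w) t).
Hypothesis zX : forall n f, zol_class s f -> ev_measurable f ->
  (`|'E_P[fun w => (f (X_ n w) - f (X w))%R]| <= z n)%E.
Hypothesis rate : little_o_log z r (zol_order s).
Hypothesis excX : long_excursions.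

Let lr n := ln (1 / r n).

Lemma lr_ge0 n : 0 <= lr n.
Proof.
have /andP[r0 r1] := r01 n; rewrite /lr ln_ge0// div1r.
by rewrite invf_ge1.
Qed.

(** As p^m is at most a constant times 1 + l^m with l = ln (1 / r n), the gap D is controlled by z n
    + z n l^m: one summand for each half of [little_o_log]. *)
Lemma rate_small (A e : R) : 0 < A -> 0 < e -> \forall n \near \oo,
  forall D p : R, 0 <= D -> 1 <= p -> p <= A * (1 + lr n) ->
  ((D / p ^+ zol_order s)%:E <= z n)%E -> D <= e.
Proof.
move=> A0 e0; have [z0 zl0] := rate; have ml2 := m2; set m := zol_order s in ml2 zl0 *.
(* The bound on p^m contributes 4 (1 + A)^2, and two summands are below e'. *)
pose e' := e / (8 * (1 + A) ^+ 2).
have A2 : 0 < (1 + A) ^+ 2 by rewrite exprn_gt0// addr_gt0.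
have e'0 : 0 < e' by rewrite divr_gt0// mulr_gt0.
have small (u : nat -> \bar R) : u n @[n --> \oo] --> 0%E ->
    \forall n \near \oo, (u n < e'%:E)%E.
  have e'0E : (0 < e'%:E)%E by rewrite lte_fin.
  by move=> u0; exact: (u0 (fun y => (y < e'%:E)%E) (open_ereal_lt' e'0E)).
near=> n => D p D0 p1 pA; have zn : (z n < e'%:E)%E by near: n; exact: small.
have zln : (z n * (lr n ^+ m)%:E < e'%:E)%E by near: n; exact: small.
have p0 : 0 < p by exact: lt_le_trans p1.
have pm0 : 0 < p ^+ m by rewrite exprn_gt0.
case: (z n) zn zln => [t| |] //=.
rewrite -EFinM !lte_fin lee_fin ler_pdivrMr// => te tle Dt.
have t0 : 0 <= t.
  by rewrite -(pmulr_lge0 _ pm0) (le_trans D0).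
have l0 := lr_ge0 n; set l := lr n in l0 tle pA *.
have key k : (k <= 2)%N -> (1 + l) ^+ k <= 4 * (1 + l ^+ k).
  by case: k => [|[|[|//]]] _; rewrite ?expr0 ?expr1; nra.
have pb : p ^+ m <= (1 + A) ^+ 2 * (4 * (1 + l ^+ m)).
  have A1 : 1 <= 1 + A by rewrite lerDl ltW.
  apply: (@le_trans _ _ ((1 + A) ^+ m * (1 + l) ^+ m)).
    rewrite -exprMn lerXn2r ?nnegrE ?(ltW p0)//.
      by rewrite mulr_ge0 ?addr_ge0 ?(ltW A0).
    by rewrite (le_trans pA)// ler_wpM2r ?addr_ge0// lerDr.
  rewrite ler_pM ?exprn_ge0 ?addr_ge0 ?(ltW A0)//; first by rewrite ler_weXn2l.
  exact: key.
rewrite (le_trans Dt)// (le_trans (ler_wpM2l t0 pb))//.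
rewrite [leLHS](_ : _ = 4 * (1 + A) ^+ 2 * (t + t * l ^+ m)); last by ring.
apply: (@le_trans _ _ (4 * (1 + A) ^+ 2 * (e' + e'))).
  apply: ler_wpM2l; first by rewrite mulr_ge0// ltW.
  by rewrite lerD// ltW.
by rewrite /e' le_eqVlt; apply/orP; left; apply/eqP; field; rewrite ?gt_eqF// addr_gt0.
Unshelve. all: by end_near. Qed.

(** All grids at once, since the grid of [finite_union_le] varies with n; a countable intersection
    stays measurable. *)
Definition close_on_grid (x : R -> R) (a : R) : set T :=
  \bigcap_j \bigcap_N [set w | (j <= N.+1)%N ->
    `|ev (X w) (grid N j) - x (grid N j)| <= a].

Lemma close_on_grid_measurable x a : measurable (close_on_grid x a).
Proof.
apply: bigcapT_measurable => j; apply: bigcapT_measurable => N.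
have [jN|jN] := boolP (j <= N.+1)%N; last first.
  by rewrite (_ : [set w | _] = setT)//; apply/seteqP; split.
have mf : measurable_fun setT (fun w => `|ev (X w) (grid N j) - x (grid N j)|).
  apply: measurableT_comp => //; apply: measurable_funB => //.
  exact/mX/grid01.
have := mf measurableT _ (measurable_itv `]-oo, a]).
rewrite setTI; congr measurable; apply/seteqP; split => w /=.
  by rewrite in_itv/= => + _.
by move=> /(_ isT); rewrite in_itv.
Qed.

(** * One finite union of balls *)

Section finite_union.
Context (x : nat -> R -> R) (a b : nat -> R) (O : set B) (q : nat).
Hypothesis cx : forall i, {within `[0, 1], continuous x i}.
Hypothesis ab : forall i, a i < b i.
Hypothesis xO : forall n w i, (i <= q)%N ->
  (forall t, t \in `[0, 1] -> `|ev (X_ n w) t - x i t| <= b i) -> O (X_ n w).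
Hypothesis mO : forall n, measurable (X_ n @^-1` O).

(** The sign bit writes the absolute value at a grid point as the maximum of two linear
    functionals. *)
Let J N : finType := ('I_N.+2 * bool)%type.
Let l N (j : J N) (y : B) : R := (-1) ^+ j.2 * ev y (grid N j.1).
(** The offset 2 g lies midway: distances up to a i fall 2 g below the threshold, distances from a i
    + 4 g on lie 2 g above it. *)
Let thr (g : R) N (i : 'I_q.+1) (j : J N) : R :=
  (-1) ^+ j.2 * x i (grid N j.1) + a i + 2 * g.

Lemma finite_union_le e : 0 < e -> \forall n \near \oo,
  (P (\bigcup_(i in `I_q.+1) close_on_grid (x i) (a i))
   <= P (X_ n @^-1` O) + e%:E)%E.
Proof.
move=> e0.
(* Of the 5 g, four separate the two sides of the threshold and one is lost in passing to an
   excursion. *)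
have [g g0 abg] : exists2 g, 0 < g & forall i, (i <= q)%N -> a i + 5 * g <= b i.
  apply: finite_lower_bound => [i|i c c' c'0 c'c].
    exists ((b i - a i) / 5); first by rewrite divr_gt0// subr_gt0.
    by rewrite le_eqVlt; apply/orP; left; apply/eqP; field.
  by move: c'0 c'c; lra.
have [c c0 exc] : exists2 c, 0 < c & forall i, (i <= q)%N -> forall n w t,
    t \in `[0, 1] -> b i < `|ev (X_ n w) t - x i t| ->
    exists a, [/\ 0 <= a, a + c * r n <= 1 &
      forall u, u \in `[a, a + c * r n] -> b i - g <= `|ev (X_ n w) u - x i u|].
  apply: finite_lower_bound => [i|i c c' c'0 c'c H n w t t01 bt].
    exact: excX.
  have [a0 [a00 a01 ha]] := H n w t t01 bt.
  have /andP[r0 _] := r01 n.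
  have cr : c' * r n <= c * r n by rewrite ler_wpM2r// ltW.
  exists a0; split => //; first by rewrite (le_trans _ a01)// lerD2l.
  move=> u; rewrite in_itv/= => /andP[u1 u2]; apply: ha.
  by rewrite in_itv/= u1 (le_trans u2)// lerD2l.
(* Three errors of this size add up: one for f on each side of the separation and one for the
   Zolotarev distance. *)
have e40 : 0 < e / 4 by rewrite divr_gt0.
have [L L1 Le] := sigmoid_small g0 e40.
have [C C1 CH] := soft_indicator_zol_class L1.
(* p n is of order ln (1 / r n), so that rate beats the factor p n ^+ m. *)
pose N n := Num.truncn (1 / (c * r n)).
pose p n := 1 + ln (2 * (N n).+2%:R * q.+1%:R) / g.
have lnN n : 0 <= ln (2 * (N n).+2%:R * q.+1%:R :> R).
  by rewrite ln_ge0// !mulr_ege1// ler1n.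
have p1 n : 1 <= p n by rewrite /p lerDl divr_ge0// ltW.
have p0 n : 0 < p n by exact: lt_le_trans (p1 n).
(* One exponent dominates both cardinalities, 2 (N n + 2) for the signed grid and q + 1 for the
   balls. *)
have pexp n : 2 * (N n).+2%:R * q.+1%:R <= expR (p n * g).
  rewrite -[leLHS]lnK ?posrE ?mulr_gt0// ler_expR.
  rewrite [leRHS](_ : _ = g + ln (2 * (N n).+2%:R * q.+1%:R)); last first.
    by rewrite /p; field; rewrite gt_eqF.
  by rewrite lerDr ltW.
have cN n : (N n).+1%:R^-1 <= c * r n.
  have /andP[r0 _] := r01 n; have cr0 : 0 < c * r n by rewrite mulr_gt0.
  have /andP[_ /ltW] : (N n)%:R <= 1 / (c * r n) < (N n).+1%:R.
    by apply: truncn_itv; rewrite divr_ge0// ltW.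
  by rewrite div1r => h; rewrite -[leRHS]invrK lef_pV2 ?posrE ?invr_gt0.
(* Since N n is at most 1 / (c r n), the logarithm in p n is at most a constant plus lr n; A
   dominates the resulting constant term and the coefficient of lr n. *)
pose A := 1 + `|ln (2 * q.+1%:R * (c^-1 + 2))| / g + g^-1.
have A0 : 0 < A.
  by rewrite /A !ltr_wpDr// ?invr_ge0 ?divr_ge0 ?(ltW g0).
have pA n : p n <= A * (1 + lr n).
  have /andP[r0 r1] := r01 n; have l0 := lr_ge0 n.
  have lnle : ln (2 * (N n).+2%:R * q.+1%:R) <=
      ln (2 * q.+1%:R * (c^-1 + 2)) + lr n.
    have q0 : 0 < 2 * q.+1%:R * (c^-1 + 2) by rewrite !mulr_gt0 ?addr_gt0 ?invr_gt0.
    have ir0 : 0 < 1 / r n by rewrite divr_gt0.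
    rewrite /lr -lnM ?posrE// ler_ln ?posrE ?(mulr_gt0 q0)// ?mulr_gt0//.
    rewrite [leLHS](_ : _ = 2 * q.+1%:R * (N n).+2%:R); last by ring.
    rewrite -[leRHS]mulrA ler_wpM2l// mulrDl.
    have : (N n)%:R <= 1 / (c * r n).
      have crn : 0 <= 1 / (c * r n) by rewrite divr_ge0// ltW// mulr_gt0.
      by have /andP[] := truncn_itv crn.
    have -> : 1 / (c * r n) = c^-1 * (1 / r n) by field; rewrite ?gt_eqF.
    have : 1 <= 1 / r n by rewrite div1r invf_ge1.
    by rewrite -!natr1; lra.
  have ginv0 : 0 < g^-1 by rewrite invr_gt0.
  have aln := ler_norm (ln (2 * q.+1%:R * (c^-1 + 2))).
  have nln := normr_ge0 (ln (2 * q.+1%:R * (c^-1 + 2))).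
  rewrite /p /A.
  apply: (@le_trans _ _ (1 + (`|ln (2 * q.+1%:R * (c^-1 + 2))| + lr n) * g^-1)).
    by rewrite lerD2l ler_wpM2r ?(ltW ginv0)//; move: lnle; lra.
  have : 0 <= `|ln (2 * q.+1%:R * (c^-1 + 2))| * g^-1 * lr n.
    by rewrite !mulr_ge0// ltW.
  lra.
have eC0 : 0 < e / 4 / (2 * C).
  by rewrite divr_gt0// mulr_gt0// (lt_le_trans _ C1).
near=> n.
have rs : forall D p : R, 0 <= D -> 1 <= p -> p <= A * (1 + lr n) ->
    ((D / p ^+ zol_order s)%:E <= z n)%E -> D <= e / 4 / (2 * C).
  by near: n; exact: rate_small.
pose f : B -> R := soft_indicator (@l (N n)) (@thr g (N n)) L (p n).
have mf d' (S : measurableType d') (h : S -> B) :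
    (forall t, t \in `[0, 1] -> measurable_fun setT (fun x => ev (h x) t)) ->
    measurable_fun setT (fun x => f (h x)).
  move=> mh; apply: (soft_indicator_measurable _ (ord0, true)) => j.
  apply: measurable_funM => //; apply: mh; apply: grid01.
  by rewrite -ltnS.
have f01 y : 0 <= f y <= 1 by rewrite ltW ?sigmoid_gt0//= sigmoid_le1.
have pm0 : 0 < p n ^+ zol_order s by rewrite exprn_gt0.
have C20 : 0 < 2 * C by rewrite mulr_gt0// (lt_le_trans _ C1).
pose K := 2 * C * p n ^+ zol_order s.
have K0 : 0 < K by rewrite mulr_gt0.
have zf : zol_class s (fun y => K^-1 * f y).
  apply: (CH _ _ _ (@l (N n)) (@thr g (N n)) ord0 (ord0, true) (p n) s) => //.
  - by move=> j c' u v; rewrite /l ev_lin; ring.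
  - move=> j u; rewrite /l normrM normrX normrN1 expr1n mul1r ev_bound//.
    by apply: grid01; rewrite -ltnS.
have fX w : (\bigcup_(i in `I_q.+1) close_on_grid (x i) (a i)) w ->
    1 - e / 4 <= f (X w).
  move=> [i /= iq wi]; apply: (@le_trans _ _ (sigmoid (L * g))).
    by move: Le; rewrite sigmoidN; lra.
  apply: (soft_indicator_ge (ord0, true) (i := Ordinal iq)) => //.
  - by rewrite (le_trans _ L1).
  - rewrite card_prod card_ord card_bool natrM mulrC (le_trans _ (pexp n))//.
    by rewrite ler_peMr// ?mulr_ge0// ler1n.
  - move=> [j sj]; have := wi j I (N n) I; rewrite /= -ltnS => /(_ (ltn_ord j)).
    rewrite /l /thr /= ler_norml => /andP[]; set u := ev _ _; set v := x i _.
    by case: sj; rewrite ?expr0 ?expr1; lra.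
(* Outside O the path leaves every ball; each excursion contains a grid point, and the sign of the
   difference there selects the functional. *)
have fXn w : ~ O (X_ n w) -> f (X_ n w) <= e / 4.
  move=> nO; apply: le_trans Le.
  apply: (soft_indicator_le (ord0 : 'I_q.+1) (ord0, true)) => //.
  - by rewrite (le_trans _ L1).
  - by rewrite card_ord (le_trans _ (pexp n))// ler_peMl// mulr_ege1 ?ler1n.
  - move=> i; have iq : (i <= q)%N by rewrite -ltnS.
    have /existsNP[t /not_implyP[t01 /negP]] :
        ~ forall t, t \in `[0, 1] -> `|ev (X_ n w) t - x i t| <= b i.
      by move=> H; apply: nO; exact: xO iq H.
    rewrite -ltNge => bt; have [u0 [u00 u01 hu]] := exc i iq n w t t01 bt.
    have [j jN jin] := grid_hits u00 u01 (cN n).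
    have agb : a i + 4 * g <= `|ev (X_ n w) (grid (N n) j) - x i (grid (N n) j)|.
      by apply: le_trans (hu _ jin); have := abg i iq; lra.
    have jN' : (j < (N n).+2)%N by rewrite ltnS.
    have [v0|v0] := leP 0 (ev (X_ n w) (grid (N n) j) - x i (grid (N n) j)).
      exists (Ordinal jN', false); rewrite /l /thr/= expr0 !mul1r.
      by move: agb; rewrite ger0_norm//; lra.
    exists (Ordinal jN', true); rewrite /l /thr/= expr1.
    by move: agb; rewrite ltr0_norm//; lra.
clearbody f.
have bmf (Y : T -> B) : measurable_fun setT (fun w => f (Y w)) ->
    bounded_measurable (fun w => f (Y w)).
  move=> mY; split => //; exists 1 => w; have /andP[f0 f1] := f01 (Y w).
  by rewrite ger0_norm.
have bfX : bounded_measurable (fun w => f (X w)) by apply: bmf; exact: mf.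
have bfXn : bounded_measurable (fun w => f (X_ n w)).
  by apply: bmf; apply: mf => t; exact: mX_.
have D : `|rexp P (fun w => f (X_ n w)) - rexp P (fun w => f (X w))| <= e / 4.
  have mKf : ev_measurable (fun y => K^-1 * f y).
    by move=> d' S h mh; apply: measurable_funM => //; exact: mf.
  have := zX n zf mKf.
  rewrite (_ : (fun w => _) = (fun w => K^-1 * f (X_ n w)) \- (fun w => K^-1 * f (X w)))//.
  have bK (Y : T -> B) (bY : bounded_measurable (fun w => f (Y w))) :=
    bounded_measurableZ K^-1 bY.
  rewrite rexpE; last by apply: bounded_measurableB; exact: bK.
  rewrite (rexpB P (bK _ bfXn) (bK _ bfX)) !rexpZ// -mulrBr abse_EFin normrM.
  rewrite gtr0_norm ?invr_gt0// => zD.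
  set dl := `|_ - _| in zD *; have dl0 : 0 <= dl by exact: normr_ge0.
  suff : dl / (2 * C) <= e / 4 / (2 * C) by rewrite ler_pM2r// invr_gt0.
  apply: (rs _ (p n)) => //; first by rewrite divr_ge0// ltW.
  rewrite [X in (X%:E <= _)%E](_ : _ = K^-1 * dl)//.
  by rewrite /K; field; rewrite !gt_eqF//= (lt_le_trans _ C1).
have mE : measurable (\bigcup_(i in `I_q.+1) close_on_grid (x i) (a i)).
  by apply: bigcup_measurable => i _; exact: close_on_grid_measurable.
set E := \bigcup_(i in _) _ in fX mE *.
have bE := bounded_measurable_indic mE; have bO := bounded_measurable_indic (mO n).
rewrite !rexp_indic// -EFinD lee_fin.
have bc : bounded_measurable (cst (e / 4) : T -> R) by exact: bounded_measurable_cst.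
have h1 : rexp P \1_E <= rexp P (fun w => f (X w)) + e / 4.
  rewrite -(rexp_cst P (e / 4)) -rexpD//.
  apply: rexp_le => //; first exact: bounded_measurableD.
  move=> w; rewrite /= indicE; have [wE|wE] := boolP (w \in E).
    by have := fX w (set_mem wE); rewrite /=; lra.
  by have /andP[f0 _] := f01 (X w); rewrite /= addr_ge0// ltW.
have h2 : rexp P (fun w => f (X_ n w)) <= rexp P \1_(X_ n @^-1` O) + e / 4.
  rewrite -(rexp_cst P (e / 4)) -rexpD//.
  apply: rexp_le => //; first exact: bounded_measurableD.
  move=> w; rewrite /= indicE; have [wO|wO] := boolP (w \in X_ n @^-1` O).
    by have /andP[_ f1] := f01 (X_ n w); rewrite /=; move: e40; lra.
  by rewrite /= add0r; apply: fXn => wO'; move/negP: wO; apply; exact: mem_set.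
move: (rexp P \1_E) (rexp P \1__) (rexp P (fun w => f (X w)))
  (rexp P (fun w => f (X_ n w))) D h1 h2 => pE pO fE fO.
by rewrite ler_norml => /andP[]; lra.
Unshelve. all: by end_near. Qed.

End finite_union.

Hypothesis cX : forall w, {within `[0, 1], continuous (ev (X w))}.

Lemma open_le (O : set B) : measurable (X @^-1` O) ->
  (forall n, measurable (X_ n @^-1` O)) ->
  (forall w, O (X w) -> exists2 h, 0 < h & forall y,
    (forall t, t \in `[0, 1] -> `|ev y t - ev (X w) t| <= h) -> O y) ->
  forall e, 0 < e -> \forall n \near \oo,
    (P (X @^-1` O) <= P (X_ n @^-1` O) + e%:E)%E.
Proof.
move=> mXO mXnO Oo e e0.
pose good (c : code) := forall y : B,
  (forall t, t \in `[0, 1] -> `|ev y t - center c t| <= 5 * code_width c) -> O y.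
pose cd n : code := odflt (0%N, 0%N, [::]) (unpickle n).
pose x n : R -> R := center (cd n).
(* Good cells have diameter at most 4 widths, and 5 leaves room for b. For the other codes the
   negative radii make [E n] empty and the ball inclusion vacuous. *)
pose a n : R := if `[<good (cd n)>] then 4 * code_width (cd n) else - 2.
pose b n : R := if `[<good (cd n)>] then 5 * code_width (cd n) else - 1.
pose E n := close_on_grid (x n) (a n).
have mE n : measurable (E n) by exact: close_on_grid_measurable.
have XOE : X @^-1` O `<=` \bigcup_n E n.
  move=> w /= Ow; have [h h0 hO] := Oo w Ow.
  (* 9 = 5 + 4: y lies within 5 widths of the center, the center within 4 of the path. *)
  pose k := Num.truncn (9 / h).
  have kh : 9 * k.+1%:R^-1 <= h.
    have h9 : 0 <= 9 / h by rewrite divr_ge0// ltW.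
    have /andP[_ /ltW] := truncn_itv h9.
    by rewrite ler_pdivrMr// => ?; rewrite ler_pdivrMr// mulrC.
  have [c ck cf] := cell_cover k (@cX w).
  have cc t : t \in `[0, 1] -> `|ev (X w) t - center c t| <= 4 * code_width c.
    by move=> t01; exact: cell_diam cf (center_cell cf) t01.
  have gc : good c.
    move=> y hy; apply: hO => t t01; have {}kh : 9 * code_width c <= h by rewrite /code_width ck.
    apply: le_trans kh; rewrite (le_trans (ler_distD (center c t) _ _))//.
    have := hy t t01; have := cc t t01; rewrite (distrC (ev (X w) t)); lra.
  exists (pickle c) => // j _ N _ /= jN.
  rewrite /x /a /cd pickleK/= asboolT//; apply: cc; exact: grid01.
have mUE : measurable (\bigcup_n E n) by exact: bigcupT_measurable.
have e20 : 0 < e / 2 by rewrite divr_gt0.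
(* Continuity of P from below reduces the countable union to a finite one. *)
have [q qE] : exists q, (P (\bigcup_n E n) <= P (\bigcup_(i in `I_q.+1) E i) + (e / 2)%:E)%E.
  pose F n := \bigcup_(i in `I_n.+1) E i.
  have UF : \bigcup_n F n = \bigcup_n E n.
    apply/seteqP; split => w; first by move=> [n _ [i _ Ei]]; exists i.
    by move=> [n _ En]; exists n => //; exists n => /=.
  have mF n : measurable (F n) by exact: bigcup_measurable.
  have ndF : nondecreasing_seq F.
    move=> i j ij; apply/subsetPset => w [k /= ki Ek]; exists k => //=.
    by rewrite (leq_trans ki).
  have fP A : measurable A -> P A \is a fin_num by exact: fin_num_measure.
  have mUF : measurable (\bigcup_n F n) by rewrite UF.
  have := nondecreasing_cvg_mu (mu := P) mF mUF ndF; rewrite UF => cF.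
  have lt : (P (\bigcup_n E n) - (e / 2)%:E < P (\bigcup_n E n))%E.
    by rewrite lteBlDr ?fP// lteDl ?fP// lte_fin.
  have [q _ /(_ q (leqnn q)) qE] := cF _ (open_ereal_gt' lt).
  by exists q; rewrite -leeBlDr ?fP//; exact: ltW.
have ab n : a n < b n.
  rewrite /a /b; case: ifP => _; last by rewrite ltrN2 ltr1n.
  by rewrite ltr_pM2r ?code_width_gt0// ltr_nat.
have xO n w i : (i <= q)%N ->
    (forall t, t \in `[0, 1] -> `|ev (X_ n w) t - x i t| <= b i) -> O (X_ n w).
  move=> _; rewrite /b; case: asboolP => [gi|_]; first exact: gi.
  have t01 : (0 : R) \in `[0, 1] by rewrite in_itv/= lexx ler01.
  by move=> /(_ _ t01); have := normr_ge0 (ev (X_ n w) 0 - x i 0); lra.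
have := @finite_union_le x a b O q (fun n => @center_continuous R (cd n))
  ab xO mXnO _ e20.
apply: filterS => n Pn; rewrite (@le_trans _ _ (P (\bigcup_n E n)))//.
  by apply: le_measure; rewrite ?inE.
by rewrite (le_trans qE)// [X in (_ <= _ + X%:E)%E](splitr e) EFinD addeA leeD2r.
Qed.

(** The levels h, 2h, ... below y form an initial segment, so h times their number is y rounded
    down, with error at most h. *)
Lemma layer_cake (h y : R) K : 0 < h -> 0 <= y -> y <= K.+1%:R * h ->
  h * (\sum_(k < K) (k.+1%:R * h < y)%R%:R) <= y /\
  y <= h + h * (\sum_(k < K) (k.+1%:R * h < y)%R%:R).
Proof.
move=> h0 y0; elim: K => [|K IH] yK.
  by rewrite big_ord0 mulr0 addr0; move: yK; rewrite mul1r.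
rewrite big_ord_recr/=; have [Ky|yK'] := ltP (K.+1%:R * h) y; last first.
  by rewrite addr0; exact: IH.
have -> : \sum_(k < K) (k.+1%:R * h < y)%R%:R = K%:R :> R.
  rewrite -[in RHS](card_ord K) -sumr_const; apply: eq_bigr => k _.
  rewrite (_ : _ < _ = true)//; apply: le_lt_trans Ky.
  by rewrite ler_pM2r// ler_nat ltnW// ltnS.
by rewrite natr1 mulrC; split; [exact: ltW|rewrite -[X in X + _]mul1r -mulrDl addrC natr1].
Qed.

(** Openness for the uniform distance, which Skorokhod-open sets have as well; this lets both path
    spaces share the argument. *)
Definition uniform_nbhs (O : set B) := forall x, O x ->
  exists2 h, 0 < h & forall y,
    (forall t, t \in `[0, 1] -> `|ev y t - ev x t| <= h) -> O y.

(** Up to e / 2, phi + M is h times the sum of the indicators of finitely many superlevel sets, and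
    [open_le] applies to each of them. *)
Lemma expectation_le_near (phi : B -> R) (M : R) :
  (forall x, `|phi x| <= M) -> (forall c, uniform_nbhs [set x | c < phi x]) ->
  measurable_fun setT (fun w => phi (X w)) ->
  (forall n, measurable_fun setT (fun w => phi (X_ n w))) ->
  forall e, 0 < e -> \forall n \near \oo,
    rexp P (fun w => phi (X w)) <= rexp P (fun w => phi (X_ n w)) + e.
Proof.
move=> phiM phiO mphi mphi_ e e0.
have M0 : 0 <= M by exact: le_trans (phiM 0).
pose h := e / 2; have h0 : 0 < h by rewrite divr_gt0.
pose K := Num.truncn (2 * M / h).
have KM : 2 * M <= K.+1%:R * h.
  have h9 : 0 <= 2 * M / h by rewrite divr_ge0 ?mulr_ge0// ltW.
  by have /andP[_ /ltW] := truncn_itv h9; rewrite ler_pdivrMr.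
pose O k := [set x | k.+1%:R * h - M < phi x].
have mO (Y : T -> B) k : measurable_fun setT (fun w => phi (Y w)) ->
    measurable (Y @^-1` O k).
  move=> mY; have := mY measurableT _ (measurable_itv `]k.+1%:R * h - M, +oo[).
  rewrite setTI; congr measurable; apply/seteqP; split => w /=;
    by rewrite in_itv/= andbT.
pose S (Y : T -> B) w := h * \sum_(k < K) \1_(Y @^-1` O k) w.
have SE Y w : S Y w = h * (\sum_(k < K) (k.+1%:R * h < phi (Y w) + M)%R%:R).
  rewrite /S; congr (_ * _); apply: eq_bigr => k _.
  by rewrite indicE; congr (nat_of_bool _)%:R; apply/idP/idP;
    [move=> /set_mem /=; rewrite /O/=|move=> ?; apply: mem_set; rewrite /O/=];
    rewrite ltrBlDr.
have Sle Y w : S Y w <= phi (Y w) + M /\ phi (Y w) + M <= h + S Y w.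
  rewrite SE; apply: layer_cake => //.
    by have := phiM (Y w); rewrite ler_norml => /andP[+ _]; lra.
  by apply: le_trans KM; have := phiM (Y w); rewrite ler_norml => /andP[_ +]; lra.
(* Each of the K level sets may lose h', at a total cost of h K h' <= h. *)
pose h' : R := K.+1%:R^-1.
have h'0 : 0 < h' by rewrite invr_gt0.
have near_all : forall K', \forall n \near \oo, forall k, (k < K')%N ->
    (P (X @^-1` O k) <= P (X_ n @^-1` O k) + h'%:E)%E.
  elim => [|K' IH]; first by apply: nearW.
  have := open_le (mO _ K' mphi) (fun n => mO _ K' (mphi_ n))
    (fun w => phiO _ (X w)) h'0.
  apply: filterS2 IH => n IH HK k; rewrite ltnS leq_eqVlt => /predU1P[->//|].
  exact: IH.
have b (Y : T -> B) k : measurable_fun setT (fun w => phi (Y w)) ->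
    bounded_measurable (\1_(Y @^-1` O k) : T -> R).
  by move=> mY; apply: bounded_measurable_indic; exact: mO.
have bS Y : measurable_fun setT (fun w => phi (Y w)) -> bounded_measurable (S Y).
  by move=> mY; apply: bounded_measurableZ; apply: bounded_measurable_sum => k; exact: b.
have bphi (Y : T -> B) : measurable_fun setT (fun w => phi (Y w)) ->
    bounded_measurable (fun w => phi (Y w)).
  by move=> mY; split => //; exists M.
have rS Y : measurable_fun setT (fun w => phi (Y w)) ->
    rexp P (S Y) = h * \sum_(k < K) rexp P \1_(Y @^-1` O k).
  move=> mY; rewrite rexpZ; last by apply: bounded_measurable_sum => k; exact: b.
  by rewrite rexp_sum// => k; exact: b.
have := near_all K; apply: filterS => n Hn.
have HS : rexp P (S X) <= rexp P (S (X_ n)) + h.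
  rewrite !rS//; apply: (@le_trans _ _ (h * \sum_(k < K)
     (rexp P \1_(X_ n @^-1` O k) + h'))).
    rewrite ler_pM2l//; apply: ler_sum => k _.
    by rewrite -lee_fin EFinD -!rexp_indic ?Hn//; exact: mO.
  rewrite big_split/= sumr_const card_ord mulrDr lerD2l -[leRHS]mulr1 ler_pM2l//.
  by rewrite -mulr_natl ler_pdivrMr// mul1r ler_nat.
have bc c : bounded_measurable (cst c : T -> R) by exact: bounded_measurable_cst.
have hX : rexp P (fun w => phi (X w)) <= rexp P (S X) + (h - M).
  rewrite -(rexp_cst P (h - M)) -rexpD//; last exact: bS.
  apply: rexp_le; [exact: bphi|apply: bounded_measurableD => //; exact: bS|].
  by move=> w /=; have [_] := Sle X w; lra.
have hXn : rexp P (S (X_ n)) + - M <= rexp P (fun w => phi (X_ n w)).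
  rewrite -(rexp_cst P (- M)) -rexpD//; last exact: bS.
  apply: rexp_le; [apply: bounded_measurableD => //; exact: bS|exact: bphi|].
  by move=> w /=; have [+ _] := Sle (X_ n) w; lra.
have eh : e = h + h by rewrite /h -splitr.
move: (rexp P (S X)) (rexp P (S (X_ n))) (rexp P (fun w => phi (X w)))
  (rexp P (fun w => phi (X_ n w))) HS hX hXn => SX SXn pX pXn.
by rewrite eh; lra.
Qed.

(** The one-sided estimate for phi and for - phi. *)
Lemma cvg_expectation (phi : B -> R) (M : R) :
  (forall x, `|phi x| <= M) -> (forall c, uniform_nbhs [set x | c < phi x]) ->
  (forall c, uniform_nbhs [set x | phi x < c]) ->
  measurable_fun setT (fun w => phi (X w)) ->
  (forall n, measurable_fun setT (fun w => phi (X_ n w))) ->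
  ('E_P[fun w => phi (X_ n w)] @[n --> \oo] --> 'E_P[fun w => phi (X w)])%E.
Proof.
move=> phiM phiO phiO' mphi mphi_.
have b (Y : T -> B) : measurable_fun setT (fun w => phi (Y w)) ->
    bounded_measurable (fun w => phi (Y w)).
  by move=> mY; split => //; exists M.
rewrite (_ : (fun n => _) = (fun n => (rexp P (fun w => phi (X_ n w)))%:E)); last first.
  by apply/funext => n; rewrite rexpE//; exact: b.
rewrite rexpE; last exact: b.
apply: cvg_EFin; first exact: nearW.
apply/cvgrPdist_le => e e0.
have lo := expectation_le_near phiM phiO mphi mphi_ e0.
have phiNM x : `|- phi x| <= M by rewrite normrN.
have phiNO c : uniform_nbhs [set x | c < - phi x].
  rewrite (_ : [set x | _] = [set x | phi x < - c]); first exact: phiO'.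
  by apply/seteqP; split => x /=; rewrite ltrNr.
have mN (Y : T -> B) : measurable_fun setT (fun w => phi (Y w)) ->
    measurable_fun setT (fun w => - phi (Y w)).
  by move=> mY; exact: measurableT_comp.
have hi := expectation_le_near phiNM phiNO (mN _ mphi) (fun n => mN _ (mphi_ n)) e0.
apply: filterS2 lo hi => n; rewrite /=.
have rN (Y : T -> B) : measurable_fun setT (fun w => phi (Y w)) ->
    rexp P (fun w => - phi (Y w)) = - rexp P (fun w => phi (Y w)).
  move=> mY; rewrite -mulN1r -rexpZ; last exact: b.
  by congr rexp; apply/funext => w; rewrite mulN1r.
rewrite !rN//.
move: (rexp P (fun w => phi (X w))) (rexp P (fun w => phi (X_ n w))) => pX pXn h1 h2.
by rewrite ler_norml; apply/andP; split; lra.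
Qed.

End zolotarev_convergence.

(** * Piecewise paths *)

Lemma zol_order_itv (R : realType) (s : R) : 0 < s -> s <= 3 ->
  [/\ (zol_order s <= 2)%N, 0 < s - (zol_order s)%:R & s - (zol_order s)%:R <= 1].
Proof.
move=> s0 s3; have /andP[] := ceil_itv s; rewrite /zol_order.
have : Num.ceil s <= 3 by rewrite ceil_le_int.
have : 0 < Num.ceil s by rewrite ceil_gt_int.
case: (Num.ceil s) => [[|n]|//] //= _ n3; rewrite -natz intrB !natz /= => h1 h2.
move: h1 h2; rewrite -!pmulrn -natr1 => h1 h2; split; [by []|lra|lra].
Qed.

Section meshes.
Context {R : realType}.
Implicit Types (r : R) (t : nat -> R).

Lemma mesh_ge_homo r l t : mesh_ge r l t ->
  forall i j, (i <= j <= l)%N -> t i <= t j.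
Proof.
move=> [_ _ tS] i; elim => [|j IH] /andP[ij jl]; first by move: ij; rewrite leqn0 => /eqP->.
move: ij; rewrite leq_eqVlt ltnS => /predU1P[->//|ij].
by rewrite (le_trans (IH _))// ?ij ?(ltnW jl)// ltW; case: (tS j jl).
Qed.

Lemma mesh_ge_pos r l t : mesh_ge r l t -> (0 < l)%N.
Proof.
by move=> [t0 t1 _]; case: l t1 => // t1; have := oner_neq0 R; rewrite -t1 t0 eqxx.
Qed.

Lemma mesh_ge_itv r l t i : mesh_ge r l t -> (i < l)%N -> 0 <= t i /\ t i.+1 <= 1.
Proof.
move=> mt il; have H := mesh_ge_homo mt; case: mt => t0 t1 _; split.
  by rewrite -t0 H//= ltnW.
by rewrite -t1 H// il leqnn.
Qed.

Lemma mesh_ge_le1 r l t : mesh_ge r l t -> r <= 1.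
Proof.
move=> mt; have l0 := mesh_ge_pos mt; have [t0 t1] := mesh_ge_itv mt l0.
case: (mt) => tt _ /(_ _ l0)[_]; rewrite tt subr0 => /le_trans; apply.
by rewrite ger0_norm// -tt (mesh_ge_homo mt).
Qed.

Lemma mesh_ge_step r l t i : mesh_ge r l t -> (i < l)%N -> r <= t i.+1 - t i.
Proof.
move=> [_ _ tS] il; have [ti] := tS i il.
by rewrite gtr0_norm// subr_gt0.
Qed.

Lemma mesh_ge_cell r l t u : mesh_ge r l t -> 0 <= u -> u < 1 ->
  exists2 i, (i < l)%N & t i <= u < t i.+1.
Proof.
move=> [t0 t1 _] u0; rewrite -t1; elim: l {t1} => [|l IH]; first by rewrite t0 ltNge u0.
have [/IH[i il ui] _|lu ul] := ltP u (t l); first by exists i => //; exact: ltnW.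
by exists l => //; rewrite lu.
Qed.

(** Clipping [t0 - h, t0 + h] to [p, q] yields all of [p, q] or an interval reaching h beyond t0 on
    one side. *)
Lemma mesh_window (p q r h t0 : R) : 0 < r -> 0 < h -> r <= q - p -> p <= t0 <= q ->
  exists a b, [/\ p <= a <= t0, t0 <= b <= q, Num.min r h <= b - a &
    forall u, a <= u <= b -> `|t0 - u| <= h].
Proof.
move=> r0 h0 rpq /andP[pt tq].
exists (Num.max p (t0 - h)), (Num.min q (t0 + h)); split.
- by apply/andP; split; [rewrite le_max lexx|rewrite ge_max pt gerBl ltW].
- by apply/andP; split; [rewrite le_min tq lerDl ltW|rewrite ge_min lexx].
- by rewrite ge_min; have [] := leP p (t0 - h); have [] := leP q (t0 + h);
    move=> *; apply/orP; first [by left; lra|by right; lra].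
- move=> u; rewrite ge_max le_min => /andP[/andP[_ u1] /andP[_ u2]].
  by rewrite ler_distlC; lra.
Qed.

(** The absolute value of an affine function peaks at an end of the segment, and close to the larger
    end value A it is at least (1 - k) |A| - k |B|. *)
Lemma affine_large (A B : R) (b m : R) : 0 <= m <= 1 ->
  b < `|(1 - m) * A + m * B| -> `|B| <= `|A| ->
  b < `|A| /\ forall k, 0 <= k <= 1 -> (1 - 2 * k) * `|A| <= `|(1 - k) * A + k * B|.
Proof.
move=> /andP[m0 m1] bm BA; split.
  apply: (lt_le_trans bm); rewrite (le_trans (ler_normD _ _))//.
  rewrite !normrM (ger0_norm m0) (@ger0_norm _ (1 - m)) ?subr_ge0//.
  by have := ler_wpM2l m0 BA; lra.
move=> k /andP[k0 k1].
have -> : (1 - k) * A + k * B = (1 - k) * A - (- (k * B)) by ring.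
apply: le_trans (lerB_dist _ _); rewrite normrN !normrM (ger0_norm k0).
rewrite (@ger0_norm _ (1 - k)) ?subr_ge0//.
by have := ler_wpM2l k0 BA; lra.
Qed.

End meshes.

(** * Excursions of piecewise paths from a continuous function *)

Section excursions.
Context {R : realType}.
Implicit Types (x f : R -> R).

Definition excursion (c b g r : R) (x f : R -> R) :=
  exists a, [/\ 0 <= a, a + c * r <= 1 &
    forall u, u \in `[a, a + c * r] -> b - g <= `|f u - x u|].

(** On a window where x varies by less than g / 4, consider the affine function f - x t0: it is
    large at one end and stays large on a fixed fraction lam of the window. *)
Lemma affine_excursion x b g : {within `[0, 1], continuous x} -> 0 < g ->
  exists2 c, 0 < c & forall r f, 0 < r <= 1 ->
    (exists l t, mesh_ge r l t /\ forall i, (i < l)%N -> exists a b,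
       forall u, u \in `[t i, t i.+1] -> f u = a * u + b) ->
    forall t0, t0 \in `[0, 1] -> b < `|f t0 - x t0| -> excursion c b g r x f.
Proof.
(* If b <= g, the bound b - g is trivial; otherwise b > 0 and lam is below 1/2. *)
move=> cx g0; have [bg|gb] := lerP b g.
  exists 1 => // r f /andP[_ r1] _ t0 _ _; exists 0; rewrite mul1r add0r; split => //.
  by move=> u _; rewrite (le_trans _ (normr_ge0 _))// subr_le0.
have b0 : 0 < b by exact: lt_trans gb.
have g40 : 0 < g / 4 by rewrite divr_gt0.
have [h h0 xh] := within_unif_continuous cx g40.
pose h2 := h / 2; have h20 : 0 < h2 by rewrite divr_gt0.
(* This makes (1 - 2 lam) b = b - g / 2; with the variation of x the total loss stays below g. *)
pose lam := g / (4 * b); have lam0 : 0 < lam by rewrite divr_gt0// mulr_gt0.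
have lamb : lam * b = g / 4 by rewrite /lam; field; rewrite gt_eqF.
have lam1 : lam <= 1 by rewrite /lam ler_pdivrMr ?mulr_gt0//; lra.
(* As r <= 1, a window of length at least min (r, h2) is at least min (1, h2) r long. *)
pose c := lam * Num.min 1 h2.
have m0 : 0 < Num.min 1 h2 by rewrite lt_min ltr01.
have c0 : 0 < c by rewrite mulr_gt0.
exists c => // r f /andP[r0 r1] [l [t [mt ft]]] t0 t01 bt0.
have [i il /andP[ti1 ti2]] : exists2 i, (i < l)%N & t i <= t0 <= t i.+1.
  move: t01; rewrite in_itv/= => /andP[t00]; rewrite le_eqVlt => /predU1P[->|t01].
    exists l.-1; first by rewrite prednK// (mesh_ge_pos mt).
    rewrite prednK ?(mesh_ge_pos mt)//; have [_ tl _] := mt.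
    by rewrite tl lexx andbT -tl (mesh_ge_homo mt)// leq_pred leqnn.
  have [i il /andP[i1 i2]] := mesh_ge_cell mt t00 t01.
  by exists i => //; rewrite i1 ltW.
have [al [be fE]] := ft i il; have [t0i t1i] := mesh_ge_itv mt il.
have ti12 : t i <= t0 <= t i.+1 by rewrite ti1.
have [p [q [/andP[pi pt] /andP[tq qi] wr wh]]] :=
  mesh_window r0 h20 (mesh_ge_step mt il) ti12.
pose w := q - p; pose G u := al * u + be - x t0.
have wcr : c * r <= lam * w.
  rewrite /c -mulrA ler_wpM2l ?(ltW lam0)//; apply: le_trans wr.
  rewrite le_min; apply/andP; split.
    by rewrite ler_piMl ?(ltW r0)// ge_min lexx.
  rewrite (@le_trans _ _ (Num.min 1 h2))//; first by rewrite ler_piMr// ltW.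
  by rewrite ge_min lexx orbT.
have w0 : 0 < w by apply: lt_le_trans wr; rewrite lt_min r0.
have inpq u : p <= u <= q -> [/\ u \in `[0, 1], `|t0 - u| < h & f u = al * u + be].
  move=> puq; have /andP[pu uq] := puq.
  have u01 : u \in `[0, 1].
    by rewrite in_itv/= (le_trans (le_trans t0i pi) pu) (le_trans uq (le_trans qi t1i)).
  split => //.
    by rewrite (le_lt_trans (wh u puq))// /h2 ltr_pdivrMr// ltr_pMr// ltr1n.
  by apply: fE; rewrite in_itv/= (le_trans pi pu) (le_trans uq qi).
have bG : b < `|G t0|.
  by rewrite /G -(_ : f t0 = al * t0 + be)//; apply: fE; rewrite in_itv/= ti1.
have big k A B : b < `|A| -> 0 <= k <= lam ->
    (1 - 2 * k) * `|A| <= `|(1 - k) * A + k * B| ->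
    b - g / 2 <= `|(1 - k) * A + k * B|.
  move=> bA /andP[k0 kl]; apply: le_trans.
  have k2 : 0 <= 1 - 2 * k.
    suff : lam <= 1 / 2 by lra.
    by rewrite /lam ler_pdivrMr ?mulr_gt0//; lra.
  apply: le_trans (ler_wpM2l k2 (ltW bA)).
  by have := ler_wpM2r (ltW b0) kl; rewrite lamb; lra.
have fin u : p <= u <= q -> b - g / 2 <= `|G u| -> b - g <= `|f u - x u|.
  move=> puq bGu; have [u01 uh fu] := inpq u puq.
  have xu := xh _ _ t01 u01 uh; rewrite fu.
  rewrite (_ : al * u + be - x u = G u - (x u - x t0)); last by rewrite /G; ring.
  apply: le_trans (lerB_dist _ _); rewrite (distrC (x u)).
  by move: xu bGu; set X := `|_ - _|; set Y := `|_|; lra.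
have Gk u k : u = (1 - k) * p + k * q -> G u = (1 - k) * G p + k * G q.
  by move=> ->; rewrite /G; ring.
pose m := (t0 - p) / w.
have m01 : 0 <= m <= 1.
  apply/andP; split; first by apply: divr_ge0; [rewrite subr_ge0|exact: ltW].
  by rewrite /m ler_pdivrMr// mul1r lerD2r.
have Gm : G t0 = (1 - m) * G p + m * G q.
  by apply: Gk; rewrite /m /w; field; rewrite gt_eqF.
have k01 k : 0 <= k <= lam -> 0 <= k <= 1.
  by move=> /andP[-> /le_trans]; exact.
have crw : c * r <= w by rewrite (le_trans wcr)// ler_piMl// ltW.
have cr0 : 0 < c * r by rewrite mulr_gt0.
have pcr : p + c * r <= q by rewrite -lerBrDl.
have p0 : 0 <= p by exact: le_trans pi.
have q1 : q <= 1 by exact: le_trans t1i.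
(* The excursion is placed at the end of the window where |G| is larger; it need not contain t0. *)
rewrite Gm in bG; have [qp|/ltW pq] := lerP `|G q| `|G p|.
  have [bp lar] := affine_large m01 bG qp.
  exists p; split => //; first exact: le_trans pcr q1.
  move=> u; rewrite in_itv/= => /andP[u1 u2].
  have k0l : 0 <= (u - p) / w <= lam.
    apply/andP; split; first by apply: divr_ge0; [rewrite subr_ge0|exact: ltW].
    by rewrite ler_pdivrMr// (le_trans _ wcr)// lerBlDl.
  apply: fin; first by rewrite u1 (le_trans u2).
  rewrite (Gk u ((u - p) / w)); first by apply: big => //; apply: lar; exact: k01.
  by rewrite /w; field; rewrite gt_eqF.
have Gm' : G t0 = (1 - (1 - m)) * G q + (1 - m) * G p by rewrite Gm; ring.
have m01' : 0 <= 1 - m <= 1 by case/andP: m01 => m0' m1'; rewrite subr_ge0 m1' gerBl.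
rewrite -Gm Gm' in bG; have [bp lar] := affine_large m01' bG pq.
exists (q - c * r); split; [by rewrite (le_trans p0)// lerBrDr|by rewrite subrK|].
move=> u; rewrite subrK in_itv/= => /andP[u1 u2].
have k0l : 0 <= (q - u) / w <= lam.
  apply/andP; split; first by apply: divr_ge0; [rewrite subr_ge0|exact: ltW].
  by rewrite ler_pdivrMr// (le_trans _ wcr)// lerBlDl -lerBlDr.
apply: fin; first by rewrite u2 andbT (le_trans _ u1)// lerBrDr.
rewrite (Gk u (1 - (q - u) / w)); last by rewrite /w; field; rewrite gt_eqF.
rewrite [X in `|X|](_ : _ = (1 - (q - u) / w) * G q + (q - u) / w * G p); last by ring.
by apply: big => //; apply: lar; exact: k01.
Qed.

Lemma step_excursion x b g : {within `[0, 1], continuous x} -> 0 < g ->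
  exists2 c, 0 < c & forall r f, 0 < r <= 1 ->
    (exists l t, mesh_ge r l t /\ forall i, (i < l)%N -> exists c,
       forall u, u \in `[t i, t i.+1[ -> f u = c) ->
    f u @[u --> 1^'-] --> f 1 ->
    forall t0, t0 \in `[0, 1] -> b < `|f t0 - x t0| -> excursion c b g r x f.
Proof.
move=> cx g0; have [h h0 xh] := within_unif_continuous cx g0.
pose h2 := h / 2; have h20 : 0 < h2 by rewrite divr_gt0.
(* Half of the window stays clear of the right end of the piece, where f may jump. *)
pose c := Num.min 1 h2 / 2.
have m0 : 0 < Num.min 1 h2 by rewrite lt_min ltr01.
have c0 : 0 < c by rewrite divr_gt0.
exists c => // r f /andP[r0 r1] [l [t [mt ft]]] f1 t0 t01 bt0.
have [i il [ti12 [v [fv ft0]]]] : exists2 i, (i < l)%N & t i <= t0 <= t i.+1 /\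
    exists v, (forall u, u \in `[t i, t i.+1[ -> f u = v) /\ f t0 = v.
  move: t01; rewrite in_itv/= => /andP[t00]; rewrite le_eqVlt => /predU1P[->|t01].
    (* At t0 = 1, which no half-open piece contains, continuity of f at 1 supplies the value of the
       last piece. *)
    have ll : (l.-1 < l)%N by rewrite prednK// (mesh_ge_pos mt).
    have lE : l.-1.+1 = l by rewrite prednK// (mesh_ge_pos mt).
    exists l.-1 => //; have [v fv] := ft _ ll; have [_ tl tS] := mt.
    have [tl1 _] := tS _ ll; rewrite lE tl in fv tl1 *.
    split; first by rewrite ltW//= lexx.
    exists v; split => //.
    have fv' : f u @[u --> 1^'-] --> v.
      apply: cvg_near_cst; near=> u; apply: fv; rewrite in_itv/=.
      by apply/andP; split; [apply: ltW|]; near: u; [exact: nbhs_left_gt|exact: nbhs_left_lt].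
    exact: (cvg_unique _ f1 fv').
  have [i il i12] := mesh_ge_cell mt t00 t01; have [v fv] := ft i il.
  exists i => //; have /andP[i1 i2] := i12; split; first by rewrite i1 ltW.
  by exists v; split => //; apply: fv; rewrite in_itv.
have [t0i t1i] := mesh_ge_itv mt il.
have [p [q [/andP[pi pt] /andP[tq qi] wr wh]]] :=
  mesh_window r0 h20 (mesh_ge_step mt il) ti12.
have mw : Num.min 1 h2 * r <= q - p.
  apply: le_trans wr; rewrite le_min; apply/andP; split.
    by rewrite ler_piMl ?(ltW r0)// ge_min lexx.
  rewrite (@le_trans _ _ (Num.min 1 h2))//; first by rewrite ler_piMr// ltW.
  by rewrite ge_min lexx orbT.
have mr0 : 0 < Num.min 1 h2 * r by rewrite mulr_gt0.
have crE : c * r = (Num.min 1 h2 * r) / 2 by rewrite /c; ring.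
exists p; split; [exact: le_trans pi| |].
  by rewrite crE; move: mw mr0; set X := _ * r; lra.
move=> u; rewrite in_itv/= => /andP[u1 u2].
have uq : u < q.
  by move: u2; rewrite crE; move: mw mr0; set X := _ * r; lra.
have u01 : u \in `[0, 1].
  by rewrite in_itv/= (le_trans (le_trans t0i pi) u1) (le_trans (ltW uq) (le_trans qi t1i)).
have uh : `|t0 - u| < h.
  rewrite (le_lt_trans (wh u _)) ?u1 ?(ltW uq)//.
  by rewrite /h2 ltr_pdivrMr// ltr_pMr// ltr1n.
have fu : f u = f t0.
  by rewrite ft0; apply: fv; rewrite in_itv/= (le_trans pi u1) (lt_le_trans uq qi).
have xu := xh _ _ t01 u01 uh.
rewrite fu (_ : f t0 - x u = f t0 - x t0 - (x u - x t0)); last by ring.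
apply: le_trans (lerB_dist _ _); rewrite (distrC (x u)).
by move: xu bt0; set X := `|_ - _|; set Y := `|_|; lra.
Unshelve. all: by end_near. Qed.

End excursions.

(** * The path spaces *)

Section path_spaces.
Context {R : realType}.

Lemma measurable_fun_lt d (S : measurableType d) (f : S -> R) :
  (forall c, measurable [set x | f x < c]) -> measurable_fun setT f.
Proof.
move=> mf; apply: (measurability _ (RGenInftyO.measurableE R)) => _ /= [_ [c ->] <-].
by rewrite setTI; have := mf c; congr measurable.
Qed.

Lemma C01_open_measurable (A : set (C01 R)) : open A -> measurable A.
Proof. by move=> oA; exact: (@sub_sigma_algebra _ setT (@open (C01 R)) A oA). Qed.

Lemma Dsk_open_measurable (A : set (Dsk R)) : open A -> measurable A.
Proof. by move=> oA; exact: (@sub_sigma_algebra _ setT (@open (Dsk R)) A oA). Qed.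

Lemma C01_continuous_measurable (f : C01 R -> R) : continuous f ->
  measurable_fun setT f.
Proof.
move=> cf; apply: measurable_fun_lt => c; apply: C01_open_measurable.
by apply: (@open_comp _ _ f [set y | y < c]) => [x _|]; [exact: cf|exact: open_lt].
Qed.

Lemma Dsk_continuous_measurable (f : Dsk R -> R) : continuous f ->
  measurable_fun setT f.
Proof.
move=> cf; apply: measurable_fun_lt => c; apply: Dsk_open_measurable.
by apply: (@open_comp _ _ f [set y | y < c]) => [x _|]; [exact: cf|exact: open_lt].
Qed.

Lemma C01_eval_le (x : C01 R) t : t \in `[0, 1] -> `|x t| <= `|x|.
Proof. by move=> t01; apply: le_supnorm => //; apply: continuous01_cadlag01; exact: c01P. Qed.

Lemma D01_eval_le (x : D01 R) t : t \in `[0, 1] -> `|x t| <= `|x|.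
Proof. by move=> t01; apply: le_supnorm => //; exact: d01P. Qed.

Lemma C01_eval_measurable t : t \in `[0, 1] ->
  measurable_fun setT (fun x : C01 R => x t).
Proof.
move=> t01; apply: C01_continuous_measurable.
apply: (@bounded_linear_continuous R (C01 R) 1) => // x.
by rewrite mul1r; exact: C01_eval_le.
Qed.

Lemma Dsk_open (O : set (Dsk R)) :
  (forall f, O f -> exists2 e, 0 < e & forall g, sk_close f g e -> O g) -> open O.
Proof.
move=> Oe; rewrite openE => f /Oe[e e0 eO].
apply/nbhs_ballP; exists e => //= g; rewrite ballEmdist /= => /d_sk_lt[_].
exact: eO.
Qed.

(** A small time change keeps the witness u inside the open interval, so tau u is a witness for
    nearby paths. *)
Lemma Dsk_open_ex (a b c : R) : 0 <= a -> b <= 1 ->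
  open [set f : Dsk R | exists2 u, a < u < b & c < (f : D01 R) u].
Proof.
move=> a0 b1; apply: Dsk_open => f [u /andP[au ub] cu].
exists (Num.min (f u - c) (Num.min (u - a) (b - u))).
  by rewrite !lt_min !subr_gt0 cu au.
have u01 : u \in `[0, 1] by rewrite in_itv/= (le_trans a0 (ltW au)) (le_trans (ltW ub) b1).
move=> g [tau tt /(_ u u01)[]]; rewrite !lt_min => /andP[fg _] /and3P[_ t1 t2].
exists (tau u).
  by move: t1 t2; rewrite !ltr_norml => /andP[? _] /andP[_ ?]; apply/andP; split; lra.
by move: fg; rewrite ltr_norml => /andP[_]; lra.
Qed.

Lemma time_change1 (tau : R -> R) : time_change tau -> tau 1 = 1.
Proof.
move=> [[tf _ ts] th]; have o01 : (1 : R) \in `[0, 1] by rewrite in_itv/= ler01 lexx.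
have [u u01 tu] := ts 1 o01; move: (u01); rewrite /= in_itv/= => /andP[_].
rewrite le_eqVlt => /predU1P[ue|u1]; first by rewrite -{1}ue.
have := th _ _ u01 o01 u1; rewrite tu ltNge.
by have := tf _ o01; rewrite /= in_itv/= => /andP[_ ->].
Qed.

(** Evaluation at t < 1 need not be Skorokhod continuous. By right continuity, f t < c means that f
    is at most some c - 1 / (j + 1) on some interval to the right of t, and the negation of each
    such condition is open. *)
Lemma Dsk_eval_measurable t : t \in `[0, 1] ->
  measurable_fun setT (fun x : Dsk R => (x : D01 R) t).
Proof.
rewrite in_itv/= => /andP[t0]; rewrite le_eqVlt => /predU1P[->|t1].
  (* Time changes fix 1, so the sublevel sets of evaluation at 1 are open. *)
  apply: measurable_fun_lt => c; apply: Dsk_open_measurable; apply: Dsk_open => f fc.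
  exists (c - f 1); first by rewrite subr_gt0.
  move=> g [tau tt /(_ 1)[]]; first by rewrite in_itv/= ler01 lexx.
  rewrite (time_change1 tt) ltr_norml => /andP[+ _] _.
  by rewrite /=; lra.
pose v k := t + (1 - t) / k.+1%:R.
have v1 k : v k <= 1.
  rewrite /v -lerBrDl ler_pdivrMr// ler_peMr ?ler1n// subr_ge0; exact: ltW.
have tv k : t < v k by rewrite /v ltrDl divr_gt0// subr_gt0.
apply: measurable_fun_lt => c.
have -> : [set x : Dsk R | (x : D01 R) t < c] =
    \bigcup_k \bigcup_j ~` [set f : Dsk R | exists2 u, t < u < v k &
       c - j.+1%:R^-1 < (f : D01 R) u].
  apply/seteqP; split => f /=.
    move=> fc; have [_ fr _] := d01P (f : D01 R).
    have t01 : 0 <= t < 1 by rewrite t0.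
    have e0 : 0 < (c - f t) / 2 by rewrite divr_gt0// subr_gt0.
    have := fr t t01 => /cvgrPdist_lt/(_ _ e0)[/= r r0 fu].
    pose k := Num.truncn ((1 - t) / r).
    have kr : (1 - t) / k.+1%:R < r.
      have h : 0 <= (1 - t) / r by rewrite divr_ge0// ?subr_ge0 ltW.
      have /andP[_] := truncn_itv h.
      by rewrite ltr_pdivrMr// => ?; rewrite ltr_pdivrMr// mulrC.
    pose j := Num.truncn ((c - f t) / 2)^-1.
    have jr : j.+1%:R^-1 <= (c - f t) / 2.
      have h : 0 <= ((c - f t) / 2)^-1 by rewrite invr_ge0 ltW.
      have /andP[_ /ltW hj] := truncn_itv h.
      by rewrite -[leRHS]invrK lef_pV2 ?posrE ?invr_gt0.
    exists k => //; exists j => // -[u /andP[tu uv] cu].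
    have : `|f t - f u| < (c - f t) / 2.
      apply: fu => //=; rewrite ltr0_norm ?subr_lt0// opprB ltrBlDl.
      by rewrite (lt_trans uv)// /v ltrD2l.
    rewrite ltr_norml => /andP[fu1 _]; suff : f u < f u by rewrite ltxx.
    by apply: lt_trans cu; move: fu1 jr; set e := j.+1%:R^-1; set y := d01_fun _ t; set z := d01_fun _ u; lra.
  move=> [k _ [j _ nu]].
  have [_ fr _] := d01P (f : D01 R); have t01 : 0 <= t < 1 by rewrite t0.
  have fl : f t <= c - j.+1%:R^-1.
    apply: (cvgr_to_le (fr t t01)).
    near=> u; rewrite leNgt; apply/negP => cu; apply: nu; exists u => //.
    by apply/andP; split; near: u; [exact: nbhs_right_gt|exact: nbhs_right_lt].
  by rewrite (le_lt_trans fl)// ltrBlDr ltrDl.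
apply: bigcupT_measurable => k; apply: bigcupT_measurable => j.
by apply: measurableC; apply: Dsk_open_measurable; exact: Dsk_open_ex.
Unshelve. all: by end_near. Qed.

Lemma C01_uniform_nbhs (O : set (C01 R)) : open O ->
  uniform_nbhs (fun (x : C01 R) t => x t) O.
Proof.
move=> oO x Ox; have /nbhs_ballP[e /= e0 eO] : nbhs x O by exact: open_nbhs_nbhs.
exists (e / 2); first by rewrite divr_gt0.
move=> y yx; apply: eO; rewrite -ball_normE /= distrC.
apply: (@le_lt_trans _ _ (e / 2)); last by rewrite ltr_pdivrMr// ltr_pMr// ltr1n.
exact: (@supnorm_le _ (y - x)).
Qed.

Lemma Dsk_uniform_nbhs (O : set (Dsk R)) : open O ->
  uniform_nbhs (fun (x : D01 R) t => x t) O.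
Proof.
move=> oO x Ox; have /nbhs_ballP[e /= e0 eO] : nbhs (x : Dsk R) O.
  exact: open_nbhs_nbhs.
exists (e / 3); first by rewrite divr_gt0.
have e20 : 0 < e / 2 by rewrite divr_gt0.
have e3e : e / 3 < e / 2 by rewrite ltr_pM2l// ltf_pV2 ?posrE// ltr_nat.
move=> y yx; apply: eO; rewrite ballEmdist /=.
apply: (@le_lt_trans _ _ (e / 2)); last by rewrite ltr_pdivrMr// ltr_pMr// ltr1n.
apply: d_sk_le => //; exists id; first exact: time_change_id.
by move=> t t01; rewrite subrr normr0 distrC (le_lt_trans (yx _ t01)).
Qed.

End path_spaces.

Lemma bounded_fun_le (R : realType) (S : Type) (phi : S -> R) :
  bounded_fun phi -> exists M, forall x, `|phi x| <= M.
Proof.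
move=> [M [_ phiM]]; exists (M + 1) => x.
by apply: (phiM (M + 1)); rewrite ?ltrDl.
Qed.

Theorem theorem9 (R : realType) (d : measure_display) (T : measurableType d)
    (P : probability T R) (s : R) (r : nat -> R)
    (s_gt0 : 0 < s) (s_le3 : s <= 3) (r_gt0 : forall n, 0 < r n) :
  (forall (X_ : nat -> {RV P >-> C01 R}) (X : {RV P >-> C01 R}),
     (forall n w, C01_piecewise (r n) (X_ n w)) ->
     little_o_log (fun n => zeta_C P s (X_ n) X) r (zol_order s) ->
     cvg_in_distribution P (fun n => X_ n : T -> C01 R) X)
  /\
  (forall (X_ : nat -> {RV P >-> Dsk R}) (X : {RV P >-> Dsk R}),
     (forall n w, D01_piecewise (r n) (X_ n w)) ->
     (forall w, {within `[0, 1], continuous (X w : D01 R)}) ->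
     little_o_log (fun n => zeta_D P s (X_ n) X) r (zol_order s) ->
     cvg_in_distribution P (fun n => X_ n : T -> Dsk R) X).
Proof.
have [m2 sm0 sm1] := zol_order_itv s_gt0 s_le3.
(* The bound r n <= 1 is read off the mesh of one path; a sample point exists because P has mass
   1. *)
have [w0 _] : exists w0 : T, True.
  have : (setT : set T) !=set0.
    apply/set0P/eqP => T0; have := @probability_setT _ _ _ P.
    by rewrite T0 measure0 => /esym/eqP; rewrite onee_eq0.
  by move=> [w _]; exists w.
split=> X_ X pX.
  move=> rate phi cphi /bounded_fun_le[M phiM].
  have r01 n : 0 < r n <= 1.
    by rewrite r_gt0/=; have [l [t [mt _]]] := pX n w0; exact: mesh_ge_le1 mt.
  have oX (c : R) : open [set x | c < phi x].
    by apply: (@open_comp _ _ phi [set y | c < y]) => [x _|]; [exact: cphi|exact: open_gt].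
  have oX' (c : R) : open [set x | phi x < c].
    by apply: (@open_comp _ _ phi [set y | y < c]) => [x _|]; [exact: cphi|exact: open_lt].
  have mphi := C01_continuous_measurable cphi.
  have mev (Y : {RV P >-> C01 R}) t : t \in `[0, 1] ->
      measurable_fun setT (fun w => (Y w : C01 R) t).
    move=> t01; apply: (measurableT_comp (C01_eval_measurable t01)).
    exact: measurable_funPT.
  apply: (@cvg_expectation _ _ _ _ _ (fun (x : C01 R) t => x t) s r
    (fun n => zeta_C P s (X_ n) X) (fun n => X_ n) X m2 sm0 sm1 _ _ r01 _ _ _ rate _ _
    phi M) => //.
  - by move=> t x; exact: C01_eval_le.
  - by move=> n t; exact: mev.
  - by move=> t; exact: mev.
  - by move=> n f zf _; apply: ereal_sup_ubound; exists f.
  - move=> x cx b g g0; have [c c0 H] := affine_excursion b cx g0.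
    by exists c => // n w t t01; exact: H (r01 n) (pX n w) _ t01.
  - by move=> w; have [] := c01P (X w).
  - by move=> c; exact: C01_uniform_nbhs.
  - by move=> c; exact: C01_uniform_nbhs.
  - by apply: (measurableT_comp mphi); exact: measurable_funPT.
  - by move=> n; apply: (measurableT_comp mphi); exact: measurable_funPT.
move=> cX rate phi cphi /bounded_fun_le[M phiM].
have r01 n : 0 < r n <= 1.
  by rewrite r_gt0/=; have [[l [t [mt _]]] _] := pX n w0; exact: mesh_ge_le1 mt.
have oX (c : R) : open [set x | c < phi x].
  by apply: (@open_comp _ _ phi [set y | c < y]) => [x _|]; [exact: cphi|exact: open_gt].
have oX' (c : R) : open [set x | phi x < c].
  by apply: (@open_comp _ _ phi [set y | y < c]) => [x _|]; [exact: cphi|exact: open_lt].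
have mphi := Dsk_continuous_measurable cphi.
have mev (Y : {RV P >-> Dsk R}) t : t \in `[0, 1] ->
    measurable_fun setT (fun w => (Y w : D01 R) t).
  move=> t01; apply: (measurableT_comp (Dsk_eval_measurable t01)).
  exact: measurable_funPT.
apply: (@cvg_expectation _ _ _ _ (D01 R) (fun (x : D01 R) t => x t) s r
  (fun n => zeta_D P s (X_ n) X) (fun n => X_ n) X m2 sm0 sm1 _ _ r01 _ _ _ rate _ _
  phi M) => //.
- by move=> t x; exact: D01_eval_le.
- by move=> n t; exact: mev.
- by move=> t; exact: mev.
(* Taking the identity of [Dsk R] in [ev_measurable] shows that f is Borel for [d_sk], as [zeta_D]
   demands. *)
- move=> n f zf mf; apply: ereal_sup_ubound; exists f => //; split => //=.
  by apply: (mf _ (Dsk R) id) => t; exact: Dsk_eval_measurable.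
- move=> x cx b g g0; have [c c0 H] := step_excursion b cx g0.
  exists c => // n w t t01; have [pXn pX1] := pX n w.
  exact: H (r01 n) pXn pX1 _ t01.
- by move=> c; exact: Dsk_uniform_nbhs.
- by move=> c; exact: Dsk_uniform_nbhs.
- by apply: (measurableT_comp mphi); exact: measurable_funPT.
- by move=> n; apply: (measurableT_comp mphi); exact: measurable_funPT.
Qed.
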